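(* The following problem is undecidable: given a labeled priced timed automaton $\mathcal{A}$ with two clocks and a single cost function which is stopwatch (all location rates in $\{0,1\}$), and a WMTL formula $\varphi$, decide whether there exists a finite run of $\mathcal{A}$ starting in the initial state (initial location, all clocks $0$) that satisfies $\varphi$.
   Context: A priced timed automaton (PTA) is $\mathcal{A}=(Q,q_0,X,E,\mathrm{Inv},(\mathrm{cost}_i)_i)$: finite locations $Q$, initial $q_0$, finite clock set $X$, transitions $E\subseteq Q\times\mathcal{C}(X)\times2^X\times Q$ with clock constraints $g::=x\sim c\mid g\wedge g$ ($x\in X$, $c\in\mathbb{N}$, $\sim\in\{<,\le,=,\ge,>\}$), invariants $\mathrm{Inv}:Q\to\mathcal{C}(X)$, cost functions $\mathrm{cost}_i:Q\cup E\to\mathbb{N}$; labeled by $\ell:Q\to2^{AP}$. A cost is stopwatch if its location rates lie in $\{0,1\}$. Semantics: discrete moves $(q,v)\xrightarrow{e}(q',v')$ for $e=(q,g,R,q')$ with $v\models g$, $v'=v[R\leftarrow0]$, $v'\models\mathrm{Inv}(q')$, costing $\mathrm{cost}_i(e)$; delay moves $(q,v)\xrightarrow{t}(q,v+t)$ if the invariant holds throughout, costing $t\cdot\mathrm{cost}_i(q)$. A mixed move is a delay followed by a discrete move; a finite run $\varrho$ is a sequence of mixed moves with length $|\varrho|$, prefixes $\varrho_{\le\pi}$, suffixes $\varrho_{\ge\pi}$, costs given by sums. WMTL: $\varphi::=a\mid\neg\varphi\mid\varphi\vee\varphi\mid\varphi\mathsf{U}_{\mathrm{cost}\sim c}\varphi$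 over finite runs: $\varrho\models a$ iff $a$ labels the first location of $\varrho$; Boolean cases as usual; $\varrho\models\varphi_1\mathsf{U}_{\mathrm{cost}\sim c}\varphi_2$ iff there is $0<\pi\le|\varrho|$ with $\varrho_{\ge\pi}\models\varphi_2$, $\varrho_{\ge\pi'}\models\varphi_1$ for all $0<\pi'<\pi$, and $\mathrm{cost}(\varrho_{\le\pi})\sim c$. *)

(* Defs.v *)
From Stdlib Require List.
From mathcomp Require Import all_boot all_order all_algebra.
From mathcomp Require Import reals.

Set Implicit Arguments.
Unset Strict Implicit.
Unset Printing Implicit Defensive.

Import Order.TTheory GRing.Theory Num.Theory.

(* Kleene's descriptions of the n-ary partial recursive functions. *)
Inductive recfun : nat -> Type :=
| RZero n : recfun n
| RSucc : recfun 1
| RProj n (i : 'I_n) : recfun n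
| RComp k n (f : recfun k) (g : 'I_k -> recfun n) : recfun n
| RPrim n (f : recfun n) (g : recfun n.+2) : recfun n.+1
| RMin n (f : recfun n.+1) : recfun n.

(* [computes f v y]: the function described by [f] is defined at [v] and has
   value [y] there. For [RPrim f g], h(0, v) = f(v) and
   h(i+1, v) = g(i, h(i, v), v), the recursion argument coming first. For
   [RMin f], the value is the least y such that f(y, v) = 0, all the f(z, v)
   with z < y being defined. *)
Fixpoint computes n (f : recfun n) : n.-tuple nat -> nat -> Prop :=
  match f in recfun n return n.-tuple nat -> nat -> Prop with
  | RZero _ => fun _ y => y = 0
  | RSucc => fun v y => y = (thead v).+1
  | RProj _ i => fun v y => y = tnth v i
  | RComp k _ f g => fun v y =>
      exists w : k.-tuple nat,
        (forall i, computes (g i) v (tnth w i)) /\ computes f w y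
  | RPrim _ f g => fun v y =>
      (fix prim (i : nat) : nat -> Prop :=
         match i with
         | 0 => computes f [tuple of behead v]
         | j.+1 => fun y => exists z,
             prim j z /\ computes g [tuple of j :: z :: behead v] y
         end) (thead v) y
  | RMin _ f => fun v y =>
      computes f [tuple of y :: v] 0 /\
      forall z, z < y -> exists u, computes f [tuple of z :: v] u.+1
  end.

(* A problem is given by its type [I] of instances, the Goedel numbering [enc]
   of the instances and the set [P] of positive instances. *)
Definition decidable_problem (I : Type) (enc : I -> nat) (P : I -> Prop) : Prop :=
  exists f : recfun 1, forall i : I,
    (P i -> computes f [tuple enc i] 1) /\ (~ P i -> computes f [tuple enc i] 0).

Definition undecidable_problem (I : Type) (enc : I -> nat) (P : I -> Prop) : Prop :=
  ~ decidable_problem enc P.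

Inductive cmp := CLt | CLe | CEq | CGe | CGt.

Definition cmp_sem (R : realType) (r : cmp) (x y : R) : bool :=
  match r with
  | CLt => (x < y)%R
  | CLe => (x <= y)%R
  | CEq => x == y
  | CGe => (x >= y)%R
  | CGt => (x > y)%R
  end.

Inductive constr (k : nat) :=
| CAtom (x : 'I_k) (r : cmp) (c : nat)
| CAnd (g1 g2 : constr k).

(* Transitions of an automaton with [k] clocks and [n] locations. *)
Record edge (k n : nat) := Edge {
  src : 'I_n;
  guard : constr k;
  resets : {set 'I_k};
  tgt : 'I_n
}.

(* Labeled priced timed automata with [k] clocks, [m] cost functions and [p]
   atomic propositions. The finite set E is listed by [edges]; [edge_cost] is
   relevant on members of this list only. *)
Record pta (k m p : nat) := PTA {
  nloc : nat;
  init : 'I_nloc;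
  edges : seq (edge k nloc);
  inv : 'I_nloc -> constr k;
  rate : 'I_m -> 'I_nloc -> nat;
  edge_cost : 'I_m -> edge k nloc -> nat;
  label : 'I_nloc -> {set 'I_p}
}.

Arguments inv {k m p} _ _.
Arguments rate {k m p} _ _ _.
Arguments edge_cost {k m p} _ _ _.
Arguments label {k m p} _ _.

Definition stopwatch k m p (A : pta k m p) (i : 'I_m) : Prop :=
  forall q, rate A i q \in [:: 0; 1].

Definition valuation (R : realType) (k : nat) := {ffun 'I_k -> R}.

Definition val0 (R : realType) k : valuation R k := [ffun=> 0%R].

Definition val_shift (R : realType) k (v : valuation R k) (t : R) :
  valuation R k := [ffun x => v x + t]%R.

Definition val_reset (R : realType) k (v : valuation R k) (Y : {set 'I_k}) :
  valuation R k := [ffun x => if x \in Y then 0%R else v x].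

Fixpoint val_sat (R : realType) k (v : valuation R k) (g : constr k) : bool :=
  match g with
  | CAtom x r c => cmp_sem r (v x) c%:R%R
  | CAnd g1 g2 => val_sat v g1 && val_sat v g2
  end.

Definition state (R : realType) k m p (A : pta k m p) : Type :=
  ('I_(nloc A) * valuation R k)%type.

Definition init_state (R : realType) k m p (A : pta k m p) : state R A :=
  (init A, val0 R k).

Definition delay_move (R : realType) k m p (A : pta k m p)
    (s : state R A) (t : R) (s' : state R A) : Prop :=
  [/\ (0 <= t)%R,
      (forall u : R, (0 <= u <= t)%R -> val_sat (val_shift s.2 u) (inv A s.1))
    & s' = (s.1, val_shift s.2 t)].

Definition discrete_move (R : realType) k m p (A : pta k m p)
    (s : state R A) (e : edge k (nloc A)) (s' : state R A) : Prop :=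
  [/\ List.In e (edges A), src e = s.1, val_sat s.2 (guard e),
      s' = (tgt e, val_reset s.2 (resets e)) & val_sat s'.2 (inv A s'.1)].

Definition mixed_move (R : realType) k m p (A : pta k m p)
    (s : state R A) (t : R) (e : edge k (nloc A)) (s' : state R A) : Prop :=
  exists2 s1, delay_move s t s1 & discrete_move s1 e s'.

(* One mixed move, with the state that it reaches. *)
Record step (R : realType) k m p (A : pta k m p) := Step {
  step_delay : R;
  step_edge : edge k (nloc A);
  step_state : state R A
}.

Record run (R : realType) k m p (A : pta k m p) := Run {
  run_first : state R A;
  run_steps : seq (step R A)
}.

Fixpoint valid_from (R : realType) k m p (A : pta k m p)
    (s : state R A) (r : seq (step R A)) : Prop :=
  match r with
  | [::] => True
  | a :: r' => mixed_move s (step_delay a) (step_edge a) (step_state a) /\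
               valid_from (step_state a) r'
  end.

Definition is_run (R : realType) k m p (A : pta k m p) (rho : run R A) : Prop :=
  valid_from (run_first rho) (run_steps rho).

Definition run_length (R : realType) k m p (A : pta k m p) (rho : run R A) : nat :=
  size (run_steps rho).

Definition run_prefix (R : realType) k m p (A : pta k m p)
    (rho : run R A) (i : nat) : run R A :=
  Run (run_first rho) (take i (run_steps rho)).

Definition run_suffix (R : realType) k m p (A : pta k m p)
    (rho : run R A) (i : nat) : run R A :=
  Run (last (run_first rho) (map (@step_state R k m p A) (take i (run_steps rho))))
      (drop i (run_steps rho)).

Fixpoint steps_cost (R : realType) k m p (A : pta k m p) (j : 'I_m)
    (s : state R A) (r : seq (step R A)) : R :=
  match r with
  | [::] => 0%R
  | a :: r' => (step_delay a * (rate A j s.1)%:R + (edge_cost A j (step_edge a))%:R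
                + steps_cost j (step_state a) r')%R
  end.

Definition run_cost (R : realType) k m p (A : pta k m p) (j : 'I_m)
    (rho : run R A) : R := steps_cost j (run_first rho) (run_steps rho).

(* Formulas over [m] cost functions and [p] atomic propositions;
   [WUntil j r c f g] is  f U_{cost_j r c} g. *)
Inductive wmtl (m p : nat) :=
| WAtom (a : 'I_p)
| WNot (f : wmtl m p)
| WOr (f g : wmtl m p)
| WUntil (j : 'I_m) (r : cmp) (c : nat) (f g : wmtl m p).

Fixpoint models (R : realType) k m p (A : pta k m p)
    (rho : run R A) (phi : wmtl m p) : Prop :=
  match phi with
  | WAtom a => a \in label A (run_first rho).1
  | WNot f => ~ models rho f
  | WOr f g => models rho f \/ models rho g
  | WUntil j r c f g =>
      exists i : nat,
        [/\ 0 < i <= run_length rho,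
            models (run_suffix rho i) g,
            (forall i', 0 < i' < i -> models (run_suffix rho i') f)
          & cmp_sem r (run_cost j (run_prefix rho i)) c%:R%R]
  end.

Record instance := Instance {
  inst_ap : nat;
  inst_pta : pta 2 1 inst_ap;
  inst_stopwatch : stopwatch inst_pta ord0;
  inst_formula : wmtl 1 inst_ap
}.

Definition has_model (R : realType) (I : instance) : Prop :=
  exists rho : run R (inst_pta I),
    [/\ is_run rho, run_first rho = init_state R (inst_pta I)
      & models rho (inst_formula I)].

(* [CodeSeq.code : seq nat -> nat] is the bijection mapping the empty sequence
   to 0 and a :: s to 2 ^ a * (2 * code s + 1); nested objects are coded
   bottom-up. *)

Definition code_cmp (r : cmp) : nat :=
  match r with CLt => 0 | CLe => 1 | CEq => 2 | CGe => 3 | CGt => 4 end.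

Definition code_set n (S : {set 'I_n}) : nat :=
  CodeSeq.code [seq nat_of_ord x | x <- enum S].

Definition code_fun n (f : 'I_n -> nat) : nat :=
  CodeSeq.code [seq f x | x <- enum 'I_n].

Fixpoint code_constr k (g : constr k) : nat :=
  match g with
  | CAtom x r c => CodeSeq.code [:: 0; nat_of_ord x; code_cmp r; c]
  | CAnd g1 g2 => CodeSeq.code [:: 1; code_constr g1; code_constr g2]
  end.

Definition code_edge k n (e : edge k n) : nat :=
  CodeSeq.code [:: nat_of_ord (src e); code_constr (guard e);
                   code_set (resets e); nat_of_ord (tgt e)].

Definition code_pta k m p (A : pta k m p) : nat :=
  CodeSeq.code
    [:: nloc A;
        nat_of_ord (init A);
        CodeSeq.code [seq CodeSeq.code [:: code_edge e;
                                           code_fun (fun j => edge_cost A j e)]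
                     | e <- edges A];
        code_fun (fun q => code_constr (inv A q));
        code_fun (fun j => code_fun (rate A j));
        code_fun (fun q => code_set (label A q))].

Fixpoint code_wmtl m p (phi : wmtl m p) : nat :=
  match phi with
  | WAtom a => CodeSeq.code [:: 0; nat_of_ord a]
  | WNot f => CodeSeq.code [:: 1; code_wmtl f]
  | WOr f g => CodeSeq.code [:: 2; code_wmtl f; code_wmtl g]
  | WUntil j r c f g =>
      CodeSeq.code [:: 3; nat_of_ord j; code_cmp r; c; code_wmtl f; code_wmtl g]
  end.

Definition code_instance (I : instance) : nat :=
  CodeSeq.code [:: inst_ap I; code_pta (inst_pta I); code_wmtl (inst_formula I)].

(* Main.v *)
(* The machine simulated by the automaton has counters c coded by the reals
   2^-c and stored along the cost axis: a run is a sequence of phases of cost 2,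
   and a phase with input x and output y visits an "in" location at cost x after
   its beginning and an "out" location at cost 1 - y before its end. Both clocks
   are free at the phase boundaries; inside, they let the automaton wait for
   durations x, 1 - x, y, 1 - y any number of times, so that the total cost is 2
   exactly when y = x, y = x / 2 or y = 2x, depending on which of these waits
   are charged. The formula requires all phases to cost 2 and each "out" to be
   followed by an "in" at distance 2k - 1, i.e. it copies the output of a phase
   to the input of the k-th next one: the k counters form a rotating queue.
   Another formula of the form U_{cost = c} fixes the number of iterations of a
   loop incrementing the first counter, which is how the machine gets its input;
   the automaton does not depend on this input.
   Recursive functions are compiled to regular expressions over counter
   instructions, and these to automata. The diagonal argument needs no universal
   machine: if f decides the problem, let A be the automaton for the machine that,
   on input b, applies f to the code of the instance made of the automaton coded
   by b and of the formula for the input b, and accepts if the value is 0. The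
   instance made of A and of the formula for the code of A is then positive if
   and only if f rejects it. *)
Require Import Defs.
From mathcomp Require Import all_boot all_order all_algebra.
From mathcomp Require Import boolp reals zify lra.

Set Implicit Arguments.
Unset Strict Implicit.
Unset Printing Implicit Defensive.

(** * Regular expressions and Glushkov's automaton *)

(** The only choice is the number of iterations of a star: compiled programs branch by leaving or
    repeating a loop. *)
Inductive regex (T : Type) :=
| Eps
| Sym (a : T)
| Cat (e1 e2 : regex T)
| Star (e : regex T).
Arguments Eps {T}.

Notation "e1 ;; e2" := (Cat e1 e2) (at level 61, right associativity).

Fixpoint lang T (e : regex T) (w : seq T) : Prop :=
  match e with
  | Eps => w = [::]
  | Sym a => w = [:: a]
  | Cat e1 e2 => exists w1 w2, [/\ w = w1 ++ w2, lang e1 w1 & lang e2 w2]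
  | Star e1 => exists2 ws, List.Forall (lang e1) ws & w = flatten ws
  end.

Definition rcat T (es : seq (regex T)) : regex T := foldr (@Cat T) Eps es.

Definition rword T (w : seq T) : regex T := rcat (map (@Sym T) w).

Lemma lang_rword T (w w' : seq T) : lang (rword w) w' <-> w' = w.
Proof.
elim: w w' => [|a w IH] w' //=; split.
  by case=> w1 [w2 [-> -> /IH ->]].
by move=> ->; exists [:: a], w; split=> //; apply/IH.
Qed.

Fixpoint rsubst T U (h : T -> regex U) (e : regex T) : regex U :=
  match e with
  | Eps => Eps
  | Sym a => h a
  | Cat e1 e2 => rsubst h e1 ;; rsubst h e2
  | Star e1 => Star (rsubst h e1)
  end.

(** Used to replace each instruction of a program by the queue word that performs it. *)
Lemma lang_rsubst_word T U (h : T -> seq U) (e : regex T) (w : seq U) :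
  lang (rsubst (fun a => rword (h a)) e) w <->
  exists2 w', lang e w' & w = flatten (map h w').
Proof.
elim: e w => [|a|e1 IH1 e2 IH2|e IH] w /=.
- split=> [->|[_ -> ->] //]; by exists [::].
- rewrite lang_rword; split=> [->|[_ -> ->] /=]; last by rewrite cats0.
  by exists [:: a]; rewrite //= cats0.
- split.
    case=> w1 [w2 [-> /IH1[v1 L1 ->] /IH2[v2 L2 ->]]].
    by exists (v1 ++ v2); [exists v1, v2 | rewrite map_cat flatten_cat].
  case=> _ [v1 [v2 [-> L1 L2]]] ->.
  exists (flatten (map h v1)), (flatten (map h v2)).
  by split; [rewrite map_cat flatten_cat|apply/IH1; exists v1|apply/IH2; exists v2].
- split.
    case=> ws F ->; elim: F => {ws} [|v ws /IH[v' Lv ->] _ [_ [vs F ->] E]].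
      by exists [::] => //; exists [::].
    exists (flatten (v' :: vs)); first by exists (v' :: vs) => //; constructor.
    by rewrite /= E map_cat flatten_cat.
  case=> _ [vs F ->] ->; exists [seq flatten (map h v) | v <- vs].
    by elim: F => {vs} [|v vs Lv _ F] /=; constructor=> //; apply/IH; exists v.
  by elim: vs {F} => //= v vs IHvs; rewrite map_cat flatten_cat IHvs.
Qed.

(* Glushkov's automaton: its states are the occurrences of symbols in [e]. *)
Fixpoint pos T (e : regex T) : finType :=
  match e with
  | Eps => void
  | Sym _ => unit
  | Cat e1 e2 => (pos e1 + pos e2)%type
  | Star e1 => pos e1
  end.

Fixpoint sym T (e : regex T) : pos e -> T :=
  match e with
  | Eps => of_void T
  | Sym a => fun=> a
  | Cat e1 e2 => fun p => match p with inl p1 => sym p1 | inr p2 => sym p2 end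
  | Star e1 => @sym T e1
  end.

Fixpoint nullable T (e : regex T) : bool :=
  match e with
  | Eps => true
  | Sym _ => false
  | Cat e1 e2 => nullable e1 && nullable e2
  | Star _ => true
  end.

Fixpoint first T (e : regex T) : pred (pos e) :=
  match e with
  | Eps => fun=> false
  | Sym _ => fun=> true
  | Cat e1 e2 => fun p =>
      match p with inl p1 => first p1 | inr p2 => nullable e1 && first p2 end
  | Star e1 => @first T e1
  end.

Fixpoint final T (e : regex T) : pred (pos e) :=
  match e with
  | Eps => fun=> false
  | Sym _ => fun=> true
  | Cat e1 e2 => fun p =>
      match p with inl p1 => nullable e2 && final p1 | inr p2 => final p2 end
  | Star e1 => @final T e1
  end.

Fixpoint follow T (e : regex T) : rel (pos e) :=
  match e with
  | Eps | Sym _ => fun _ _ => false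
  | Cat e1 e2 => fun p q =>
      match p, q with
      | inl p1, inl q1 => follow p1 q1
      | inl p1, inr q2 => final p1 && first q2
      | inr _, inl _ => false
      | inr p2, inr q2 => follow p2 q2
      end
  | Star e1 => fun p q => @follow T e1 p q || @final T e1 p && @first T e1 q
  end.

Definition accepts T (e : regex T) (s : seq (pos e)) : bool :=
  if s is p :: s' then [&& first p, path (@follow T e) p s' & final (last p s')]
  else nullable e.

Lemma accepts_cat T (e1 e2 : regex T) s1 s2 :
  accepts s1 -> accepts s2 ->
  accepts (map inl s1 ++ map inr s2 : seq (pos (e1 ;; e2))).
Proof.
have pl p s : path (@follow T (e1 ;; e2)) (inl p) (map inl s) = path (@follow T e1) p s.
  by elim: s p => //= q s IH p; rewrite IH.
have pr p s : path (@follow T (e1 ;; e2)) (inr p) (map inr s) = path (@follow T e2) p s.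
  by elim: s p => //= q s IH p; rewrite IH.
case: s1 => [|p1 s1] /=; case: s2 => [|p2 s2] /=.
- by move=> -> ->.
- by move=> -> /and3P[-> P L]; rewrite pr P (last_map inr) /= L.
- by move=> /and3P[-> P L] n2; rewrite cats0 pl P (last_map inl) /= n2 L.
- move=> /and3P[-> P1 L1] /and3P[F2 P2 L2].
  by rewrite cat_path pl P1 last_cat /= !(last_map inl) (last_map inr) /= L1 F2 pr P2.
Qed.

(** No step leads from the right summand back to the left one, so an accepting path crosses at most
    once and is cut there. *)
Lemma accepts_split T (e1 e2 : regex T) (s : seq (pos (e1 ;; e2))) :
  accepts s ->
  exists s1 s2, [/\ s = map inl s1 ++ map inr s2, accepts s1 & accepts s2].
Proof.
have right q s' : path (@follow T (e1 ;; e2)) (inr q) s' ->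
    final (last (inr q : pos (e1 ;; e2)) s') ->
    exists2 s2, s' = map inr s2 & path (@follow T e2) q s2 && final (last q s2).
  elim: s' q => [|[//|q'] s' IH] q /=; first by exists [::].
  by case/andP=> f /IH{}IH /IH[s2 -> P]; exists (q' :: s2); rewrite //= f.
have left p s' : path (@follow T (e1 ;; e2)) (inl p) s' ->
    final (last (inl p : pos (e1 ;; e2)) s') ->
    exists s1 s2, [/\ s' = map inl s1 ++ map inr s2,
      path (@follow T e1) p s1 && final (last p s1) & accepts s2].
  elim: s' p => [|[p'|q] s' IH] p /=.
  - by move=> _ /andP[n2 f]; exists [::], [::].
  - case/andP=> f /IH{}IH /IH[s1 [s2 [-> P A]]].
    by exists (p' :: s1), s2; rewrite /= f.
  - case/andP=> /andP[fp fq] /right{}IH /IH[s2 -> P].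
    by exists [::], (q :: s2); rewrite /= fp fq.
case: s => [|[p|q] s] /=.
- by case/andP=> n1 n2; exists [::], [::].
- case/and3P=> fp /left P /P[s1 [s2 [-> A1 A2]]].
  by exists (p :: s1), s2; rewrite /= fp.
- case/and3P=> /andP[n1 fq] /right P /P[s2 -> A].
  by exists [::], (q :: s2); rewrite /= n1 fq.
Qed.

Lemma accepts_star_cat T (e : regex T) s1 (s2 : seq (pos (Star e))) :
  @accepts T e s1 -> accepts s2 -> accepts (s1 ++ s2 : seq (pos (Star e))).
Proof.
have sub p s : path (@follow T e) p s -> path (@follow T (Star e)) p s.
  by apply: sub_path => x y /= ->.
case: s1 => [|p s1] //= /and3P[-> /sub P1 L1].
case: s2 => [_|q s2 /and3P[fq P2 L2]] /=; first by rewrite cats0 P1 L1.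
rewrite cat_path P1 last_cat /=; apply/andP; split; last exact: L2.
by apply/andP; split; [apply/orP; right; apply/andP|exact: P2].
Qed.

(** A step of [Star e] that is not a step of [e] goes from a final to a first position, and the path
    is cut there. *)
Lemma accepts_star_split T (e : regex T) (s : seq (pos (Star e))) :
  accepts s ->
  exists2 ss : seq (seq (pos e)), List.Forall (@accepts T e) ss & s = flatten ss.
Proof.
case: s => [_|p s] /=; first by exists [::].
(* [p'] belongs to an iteration already under way, and [s1] completes it. *)
suff split_path : forall s' p',
    path (@follow T (Star e)) p' s' -> @final T e (last p' s') ->
    exists s1, exists2 ss : seq (seq (pos e)), List.Forall (@accepts T e) ss &
    s' = s1 ++ flatten ss /\ path (@follow T e) p' s1 && @final T e (last p' s1).
  case/and3P=> fp /split_path H /H[s1 [ss F [-> A]]].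
  by exists ((p :: s1) :: ss) => //; constructor=> //=; rewrite fp.
elim=> [|q s' IH] p' /=; first by exists [::]; exists [::].
case/andP=> pq /IH{}IH /IH[s1 [ss F [E A]]].
case/orP: pq => [pq|/andP[fp fq]].
  by exists (q :: s1); exists ss; rewrite //= E pq.
exists [::]; exists ((q :: s1) :: ss); last by rewrite /= E fp.
by constructor=> //; apply/andP; split; [exact: fq|exact: A].
Qed.

Lemma glushkov T (e : regex T) (w : seq T) :
  lang e w <-> exists2 s, accepts s & w = map (@sym T e) s.
Proof.
elim: e w => [|a|e1 IH1 e2 IH2|e IH] w /=.
- by split=> [->|[[|[]]] //]; exists [::].
- split=> [->|[[|[] [|[] s]] //=]]; first by exists [:: tt].
- split.
    case=> w1 [w2 [-> /IH1[s1 A1 ->] /IH2[s2 A2 ->]]].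
    exists (map inl s1 ++ map inr s2); first exact: accepts_cat.
    by rewrite map_cat -!map_comp.
  case=> _ /accepts_split[s1 [s2 [-> A1 A2]]] ->.
  exists (map (@sym T e1) s1), (map (@sym T e2) s2).
  by rewrite map_cat -!map_comp; split=> //; [apply/IH1; exists s1|apply/IH2; exists s2].
- split.
    case=> ws F ->; elim: F => {ws} [|v ws /IH[s1 A1 ->] _ [s2 A2 E]].
      by exists [::].
    exists (s1 ++ s2); last by rewrite /= E map_cat.
    exact: accepts_star_cat.
  case=> s /accepts_star_split[ss F ->] ->; exists (map (map (@sym T e)) ss).
    by elim: F => {ss} [|v vs Lv _ F] /=; constructor=> //; apply/IH; exists v.
  by elim: ss {F} => //= v vs IHvs; rewrite map_cat IHvs.
Qed.

(** * Counter programs *)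

Inductive counter_op := Inc | Dec | Tst.

Definition instr := (counter_op * nat)%type.

Definition store := nat -> nat.

Definition upd (s : store) (r n : nat) : store := fun x => if x == r then n else s x.

(** [Dec] blocks on 0 and [Tst] on positive values. A blocked execution relates no stores, which is
    how the free choices of the stars get resolved. *)
Definition op_rel (o : counter_op) (m n : nat) : Prop :=
  match o with
  | Inc => n = m.+1
  | Dec => m = n.+1
  | Tst => m = 0 /\ n = 0
  end.

Definition instr_rel (i : instr) (s s' : store) : Prop :=
  exists2 n, op_rel i.1 (s i.2) n & s' = upd s i.2 n.

Fixpoint exec (w : seq instr) (s s' : store) : Prop :=
  if w is i :: w' then exists2 t, instr_rel i s t & exec w' t s' else s' = s.

Definition sem (e : regex instr) (s s' : store) : Prop :=
  exists2 w, lang e w & exec w s s'.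

Lemma updE s r n x : upd s r n x = if x == r then n else s x.
Proof. by []. Qed.

Lemma upd_id s r n : s r = n -> upd s r n = s.
Proof. by move=> E; apply/funext=> x; rewrite updE; case: eqP => // ->. Qed.

Lemma exec_cat w1 w2 s s' :
  exec (w1 ++ w2) s s' <-> exists2 t, exec w1 s t & exec w2 t s'.
Proof.
elim: w1 s => [|i w1 IH] s /=; first by split=> [H|[t ->]] //; exists s.
split; first by case=> t It /IH[u E1 E2]; exists u => //; exists t.
by case=> u [t It E1] E2; exists t => //; apply/IH; exists u.
Qed.

Lemma sem_eps s s' : sem Eps s s' <-> s' = s.
Proof. by split=> [[_ -> //]|->]; exists [::]. Qed.

Lemma sem_sym i s s' : sem (Sym i) s s' <-> instr_rel i s s'.
Proof.
split=> [[_ -> [t It ->]] //|It]; exists [:: i] => //.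
by exists s'.
Qed.

Lemma sem_cat e1 e2 s s' : sem (e1 ;; e2) s s' <-> exists2 t, sem e1 s t & sem e2 t s'.
Proof.
split.
  by case=> _ [w1 [w2 [-> L1 L2]]] /exec_cat[t E1 E2]; exists t; [exists w1|exists w2].
case=> t [w1 L1 E1] [w2 L2 E2]; exists (w1 ++ w2); first by exists w1, w2.
by apply/exec_cat; exists t.
Qed.

Lemma sem_inc r s s' : sem (Sym (Inc, r)) s s' <-> s' = upd s r (s r).+1.
Proof. by rewrite sem_sym; split=> [[n /= -> ->] //|->]; exists (s r).+1. Qed.

Lemma sem_dec r s s' : sem (Sym (Dec, r)) s s' <-> 0 < s r /\ s' = upd s r (s r).-1.
Proof.
rewrite sem_sym; split=> [[n /= -> ->] //|[s0 ->]].
by exists (s r).-1 => //=; rewrite prednK.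
Qed.

Lemma sem_tst r s s' : sem (Sym (Tst, r)) s s' <-> s r = 0 /\ s' = s.
Proof.
rewrite sem_sym; split=> [[n /= [E ->] ->]|[E ->]]; first by rewrite upd_id.
by exists 0 => //; rewrite upd_id.
Qed.

Lemma star_refl e s : sem (Star e) s s.
Proof. by exists [::] => //; exists [::]. Qed.

Lemma star_step e s t s' : sem e s t -> sem (Star e) t s' -> sem (Star e) s s'.
Proof.
case=> w L E [_ [ws F ->] Es]; exists (w ++ flatten ws).
  by exists (w :: ws) => //; constructor.
by apply/exec_cat; exists t.
Qed.

Lemma star_inv (P : store -> Prop) e s s' :
  (forall t t', P t -> sem e t t' -> P t') -> P s -> sem (Star e) s s' -> P s'.
Proof.
move=> step Ps [_ [ws F ->]].
elim: F s Ps => {ws} [|w ws L _ IH] s Ps; first by move=> ->.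
move=> /exec_cat[t E1]; apply: IH; apply: (step s) => //.
by exists w.
Qed.

(** * Loops and transfers between registers *)

Fixpoint iter_rel (S : Type) (Q : S -> S -> Prop) (n : nat) (s s' : S) : Prop :=
  if n is m.+1 then exists2 t, Q s t & iter_rel Q m t s' else s' = s.

(** [Dec] forbids too many iterations and the closing [Tst] too few: if [e] preserves [r], the
    number of iterations is the initial content of [r]. *)
Definition loop (r : nat) (e : regex instr) : regex instr :=
  Star (Sym (Dec, r) ;; e) ;; Sym (Tst, r).

(** The invariant [I] allows the meaning [Q] of the body to be known only on some stores, such as
    those whose scratch registers are clear. *)
Lemma sem_loop (r : nat) (e : regex instr) (Q : store -> store -> Prop) (I : store -> Prop) s s' :
  (forall t, I t -> 0 < t r -> I (upd t r (t r).-1)) ->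
  (forall t t', I t -> sem e t t' <-> Q t t') ->
  (forall t t', I t -> Q t t' -> I t' /\ t' r = t r) ->
  I s ->
  sem (loop r e) s s' <-> iter_rel (fun t => Q (upd t r (t r).-1)) (s r) s s'.
Proof.
move=> Idec eQ IQ Is; rewrite /loop sem_cat; split.
  case=> t St; rewrite sem_tst => -[t0 ->]; move: St => -[_ [ws F ->]].
  elim: F s Is => {ws} [|w ws L _ IH] s Is.
    by move=> /= <-; rewrite t0.
  move=> /exec_cat[u Eu /IH{}IH].
  have: sem (Sym (Dec, r) ;; e) s u by exists w.
  rewrite sem_cat => -[v]; rewrite sem_dec => -[s0 ->] /eQ Qu.
  have Iv := Idec _ Is s0; have {}Qu := Qu Iv; have [Iu ur] := IQ _ _ Iv Qu.
  have := IH Iu; rewrite ur updE eqxx => H.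
  by rewrite -(prednK s0) /=; exists u.
move En: (s r) => n; elim: n s Is En => [|n IH] s Is En /=.
  by move=> ->; exists s; [exact: star_refl|rewrite sem_tst].
case=> t Qt Ht; have s0 : 0 < s r by rewrite En.
have Iv := Idec _ Is s0; have [It tr] := IQ _ _ Iv Qt.
have [|u Su Tu] := IH t It _ Ht; first by rewrite tr updE eqxx En.
exists u => //; apply: star_step Su; rewrite sem_cat.
by exists (upd s r (s r).-1); [rewrite sem_dec|apply/eQ].
Qed.

Definition clear (r : nat) := loop r Eps.

Lemma sem_clear r s s' : sem (clear r) s s' <-> s' = upd s r 0.
Proof.
rewrite /clear (@sem_loop _ _ (fun t t' => t' = t) (fun=> True)) //; last first.
- by move=> t t' _ ->.
- by move=> t t' _; exact: sem_eps.
move En: (s r) => n; elim: n s En => [|n IH] s En /=; first by rewrite upd_id.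
have E : upd (upd s r (s r).-1) r 0 = upd s r 0.
  by apply/funext=> x; rewrite !updE; case: eqP.
split=> [[t ->]|H].
  by rewrite IH ?updE ?eqxx ?En // -En E.
by exists (upd s r (s r).-1) => //; apply/IH; rewrite ?updE ?eqxx ?En // -En E.
Qed.

Definition move_to (r o : nat) := loop r (Sym (Inc, o)).

Lemma sem_move_to r o s s' : r != o ->
  sem (move_to r o) s s' <-> s' = upd (upd s r 0) o (s o + s r).
Proof.
move=> ro.
rewrite /move_to (@sem_loop _ _ (fun t t' => t' = upd t o (t o).+1) (fun=> True)) //; last first.
- by move=> t t' _ ->; rewrite updE (negPf ro).
- by move=> t t' _; exact: sem_inc.
move En: (s r) => n; elim: n s En => [|n IH] s En /=.
  by rewrite (upd_id En) upd_id ?addn0.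
set t := upd (upd s r _) _ _.
have tr : t r = n by rewrite /t !updE (negPf ro) eqxx En.
have E : upd (upd t r 0) o (t o + n) = upd (upd s r 0) o (s o + n.+1).
  apply/funext=> x; rewrite /t !updE eqxx [o == r]eq_sym (negPf ro).
  by case: eqP => // _; [lia|case: eqP].
by rewrite -E -(IH t tr); split=> [[_ ->]|] //; exists t.
Qed.

(** The loop empties [r] into both [o] and the scratch register [t], from which [r] is then
    restored. *)
Definition copy (r o t : nat) := loop r (Sym (Inc, o) ;; Sym (Inc, t)) ;; move_to t r.

Lemma sem_copy r o t s s' : r != o -> r != t -> o != t -> s t = 0 ->
  sem (copy r o t) s s' <-> s' = upd s o (s o + s r).
Proof.
move=> ro rt ot st; rewrite /copy sem_cat.
have neqs := (negPf ro, negPf rt, negPf ot).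
have neqs' : ((o == r) = false) * ((t == r) = false) * ((t == o) = false).
  by rewrite ![_ == r]eq_sym [t == o]eq_sym !neqs.
pose Q (u u' : store) := u' = upd (upd u o (u o).+1) t (u t).+1.
pose fin u : store := upd (upd (upd u r 0) o (u o + u r)) t (u t + u r).
have L u : sem (loop r (Sym (Inc, o) ;; Sym (Inc, t))) s u <-> u = fin s.
  rewrite (@sem_loop _ _ Q (fun=> True)) //; last first.
  - by move=> v v' _ ->; rewrite !updE (negPf rt) (negPf ro).
  - move=> v v' _; rewrite sem_cat /Q; split.
      by case=> v1; rewrite !sem_inc => -> ->; rewrite [upd v o _ t]updE eq_sym (negPf ot).
    move=> ->; exists (upd v o (v o).+1); rewrite !sem_inc //.
    by rewrite [upd v o _ t]updE eq_sym (negPf ot).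
  rewrite /fin; move En: (s r) => n; clear s' st; elim: n s En => [|n IH] s En /=.
    by rewrite !addn0 (upd_id En) (@upd_id s o) // upd_id.
  pose v := upd s r (s r).-1.
  pose v' := upd (upd v o (v o).+1) t (v t).+1.
  have vr : v' r = n by rewrite /v' /v !updE (negPf rt) (negPf ro) eqxx En.
  have E : upd (upd (upd v' r 0) o (v' o + n)) t (v' t + n)
         = upd (upd (upd s r 0) o (s o + n.+1)) t (s t + n.+1).
    apply/funext=> x; rewrite /v' /v !updE !eqxx.
    rewrite !(neqs, neqs').
    by do !case: eqP => //; lia.
  rewrite -E -(IH v' vr); split=> [[_ ->]|H]; last exists v' => //.
  by [].
have E : upd (upd (fin s) t 0) r (fin s r + fin s t) = upd s o (s o + s r).
  apply/funext=> x; rewrite /fin !updE !eqxx st.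
  rewrite !(neqs, neqs').
  case: (x =P r) => [->|_]; first by rewrite !neqs.
  by case: (x =P t) => [->|_] //; rewrite neqs' st.
split; first by case=> u /L ->; rewrite sem_move_to ?E // eq_sym.
by move=> ->; exists (fin s); [exact/L|rewrite sem_move_to ?E // eq_sym].
Qed.

(** * Compilation of recursive functions *)

(** Arguments are passed by reference: [a i] is the register holding the i-th one, so that editing
    an argument list moves no data. *)
Definition cons_arg n (r : nat) (a : 'I_n -> nat) (i : 'I_n.+1) : nat :=
  if unlift ord0 i is Some j then a j else r.

Definition tail_arg n (a : 'I_n.+1 -> nat) : 'I_n -> nat := a \o lift ord0.

(* The value is added to register [out]; the registers from [base] on are
   scratch space, zero before and after. *)
Fixpoint compile n (f : recfun n) : ('I_n -> nat) -> nat -> nat -> regex instr :=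
  match f in recfun n return ('I_n -> nat) -> nat -> nat -> regex instr with
  | RZero _ => fun _ _ _ => Eps
  | RSucc => fun a o b => copy (a ord0) o b ;; Sym (Inc, o)
  | RProj _ i => fun a o b => copy (a i) o b
  | RComp k _ f g => fun a o b =>
      rcat [seq compile (g i) a (b + i) (b + k) | i <- enum 'I_k] ;;
      compile f (fun i => b + i) o (b + k) ;;
      rcat [seq clear (b + nat_of_ord i) | i <- enum 'I_k]
  | RPrim _ f g => fun a o b =>
      compile f (tail_arg a) (b + 1) (b + 4) ;;
      copy (a ord0) (b + 3) (b + 2) ;;
      loop (b + 3)
        (compile g (cons_arg b (cons_arg (b + 1) (tail_arg a))) (b + 2) (b + 4) ;;
         clear (b + 1) ;; move_to (b + 2) (b + 1) ;; Sym (Inc, b)) ;;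
      move_to (b + 1) o ;; clear b
  | RMin _ f => fun a o b =>
      let eval := compile f (cons_arg b a) (b + 1) (b + 2) in
      Star (eval ;; Sym (Dec, b + 1) ;; clear (b + 1) ;; Sym (Inc, b)) ;;
      eval ;; Sym (Tst, b + 1) ;; move_to b o
  end.

Definition argval n (a : 'I_n -> nat) (s : store) : n.-tuple nat :=
  [tuple s (a i) | i < n].

Lemma argval_cons n r (a : 'I_n -> nat) s :
  argval (cons_arg r a) s = [tuple of s r :: argval a s].
Proof.
apply: eq_from_tnth => i; rewrite tnth_mktuple /cons_arg.
by case: unliftP => [j|] ->; rewrite ?tnth0 // tnthS tnth_mktuple.
Qed.

Lemma argval_tail n (a : 'I_n.+1 -> nat) s :
  argval (tail_arg a) s = [tuple of behead (argval a s)].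
Proof.
apply: eq_from_tnth => i; rewrite tnth_mktuple (tnth_nth 0) nth_behead.
by have := tnth_nth 0 (argval a s) (lift ord0 i); rewrite lift0 tnth_mktuple.
Qed.

Lemma argval_head n (a : 'I_n.+1 -> nat) s : thead (argval a s) = s (a ord0).
Proof. by rewrite /thead tnth_mktuple. Qed.

Lemma eq_argval n (a : 'I_n -> nat) s s' :
  (forall i, s (a i) = s' (a i)) -> argval a s = argval a s'.
Proof. by move=> E; apply: eq_from_tnth => i; rewrite !tnth_mktuple. Qed.

(** Being an equivalence, this also says that no execution is complete where [f] is undefined, and
    that arguments and scratch registers are restored. *)
Definition compile_spec n (f : recfun n) : Prop :=
  forall (a : 'I_n -> nat) (out base : nat) (s s' : store),
  (forall i, a i < base) -> out < base -> (forall i, a i != out) ->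
  (forall x, base <= x -> s x = 0) ->
  sem (compile f a out base) s s' <->
  exists2 y, computes f (argval a s) y & s' = upd s out (s out + y).

(** The results of the inner functions of a composition. The list [l] of places already filled
    serves an induction over these functions. *)
Definition store_block (b : nat) (l : seq nat) (w : nat -> nat) (s : store) : store :=
  fun x => if (b <= x) && (x - b \in l) then w (x - b) else s x.

Lemma sem_rcat_clear b k (l : seq 'I_k) s s' :
  sem (rcat [seq clear (b + nat_of_ord i) | i <- l]) s s' <->
  s' = store_block b (map val l) (fun=> 0) s.
Proof.
elim: l s => [|i l IH] s.
  by rewrite sem_eps; split=> ->; apply/funext=> x; rewrite /store_block andbF.
have E : store_block b (map val l) (fun=> 0) (upd s (b + i) 0) =
         store_block b (map val (i :: l)) (fun=> 0) s.
  apply/funext=> x; rewrite /store_block updE /= inE.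
  case: (leqP b x) => /= bx; last by case: eqP => //; lia.
  have -> : (x == b + i) = (x - b == i) by lia.
  by case: (x - b == i); case: (_ \in _).
rewrite [rcat _]/= sem_cat -E; split.
  by case=> t; rewrite sem_clear => -> /IH.
by move=> E'; exists (upd s (b + i) 0); [rewrite sem_clear|apply/IH].
Qed.

(** Each [g i] writes to [b + i] and takes its scratch space from [b + k] on, above the whole block,
    so the results already obtained survive. *)
Lemma sem_rcat_compile k n (g : 'I_k -> recfun n) (a : 'I_n -> nat) b v (l : seq 'I_k) s s' :
  (forall i, compile_spec (g i)) -> uniq l ->
  (forall i, a i < b) -> argval a s = v ->
  (forall x, b + k <= x -> s x = 0) -> (forall i : 'I_k, i \in l -> s (b + i) = 0) ->
  sem (rcat [seq compile (g i) a (b + i) (b + k) | i <- l]) s s' <->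
  exists2 w, forall i, i \in l -> computes (g i) v (w (nat_of_ord i))
  & s' = store_block b (map val l) w s.
Proof.
move=> gP; elim: l s s' => [|i l IH] s s' /=.
  move=> _ _ _ _ _; rewrite sem_eps; split=> [->|[w _ ->]].
    by exists (fun=> 0) => //; apply/funext=> x; rewrite /store_block andbF.
  by apply/funext=> x; rewrite /store_block andbF.
case/andP=> il ul ab vE s0 sl.
have ik := ltn_ord i.
have spec t : sem (compile (g i) a (b + i) (b + k)) s t <->
    exists2 y, computes (g i) v y & t = upd s (b + i) y.
  rewrite gP //; last first.
  - by move=> j; have := ab j; lia.
  - by lia.
  - by move=> j; have := ab j; lia.
  by rewrite vE sl ?inE ?eqxx.
have IHt y t : sem (rcat [seq compile (g i) a (b + i) (b + k) | i <- l]) (upd s (b + i) y) t <->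
  exists2 w, forall i, i \in l -> computes (g i) v (w (nat_of_ord i))
  & t = store_block b (map val l) w (upd s (b + i) y).
  apply: IH => //.
  - rewrite -vE; apply: eq_argval => j; rewrite updE.
    by have := ab j; case: eqP => //; lia.
  - by move=> x bx; rewrite updE s0 //; case: eqP => //; lia.
  - move=> j jl; rewrite updE sl ?inE ?jl ?orbT //.
    case: eqP => // /addnI E.
    by move: il; rewrite -(val_inj E) jl.
have E y w : store_block b (map val l) w (upd s (b + i) y) =
    store_block b (map val (i :: l)) (fun j => if j == i :> nat then y else w j) s.
  apply/funext=> x; rewrite /store_block updE /= inE.
  case: (leqP b x) => /= bx; last by case: eqP => //; lia.
  have -> : (x == b + i) = (x - b == i) by lia.
  case: eqP => [->|//]; case: ifP => //.
  by rewrite mem_map ?(negPf il) //; exact: val_inj.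
rewrite sem_cat; split.
  case=> t /spec[y gy ->] /IHt[w gw ->]; rewrite E.
  exists (fun j => if j == i :> nat then y else w j) => // j.
  rewrite inE; case: eqP => [-> _|ji /= jl]; first by rewrite eqxx.
  by case: eqP => [/val_inj//|_]; exact: gw.
case=> w gw ->; exists (upd s (b + i) (w i)).
  by apply/spec; exists (w i) => //; apply: gw; rewrite inE eqxx.
apply/IHt; exists w => [j jl|]; first by apply: gw; rewrite inE jl orbT.
by rewrite E; congr store_block; apply/funext=> j; case: eqP => // ->.
Qed.

Lemma compile_comp k n (f : recfun k) (g : 'I_k -> recfun n) :
  compile_spec f -> (forall i, compile_spec (g i)) -> compile_spec (RComp f g).
Proof.
move=> fP gP a o b s s' ab ob ao s0 /=.
set blk := store_block b (map val (enum 'I_k)).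
have blkE w x : blk w s x = if b <= x < b + k then w (x - b) else s x.
  rewrite /blk /store_block val_enum_ord mem_iota /=.
  by congr (if _ then _ else _); lia.
have gE t : sem (rcat [seq compile (g i) a (b + i) (b + k) | i <- enum 'I_k]) s t <->
    exists2 w, forall i, computes (g i) (argval a s) (w (nat_of_ord i)) & t = blk w s.
  rewrite (sem_rcat_compile _ gP (enum_uniq 'I_k) ab erefl); last first.
  - by move=> i _; apply: s0; lia.
  - by move=> x bx; apply: s0; lia.
  split=> -[w gw ->]; exists w => // i; first by apply: gw; rewrite mem_enum.
have fE w t : sem (compile f (fun i => b + i) o (b + k)) (blk w s) t <->
    exists2 y, computes f [tuple w (nat_of_ord i) | i < k] y & t = upd (blk w s) o (s o + y).
  rewrite fP; last first.
  - by move=> x bx; rewrite blkE s0; [case: ifP => //; lia|lia].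
  - by move=> i; lia.
  - by lia.
  - by move=> i; have := ltn_ord i; lia.
  have -> : argval (fun i : 'I_k => b + i) (blk w s) = [tuple w (nat_of_ord i) | i < k].
    apply: eq_from_tnth => i; rewrite !tnth_mktuple blkE.
    by have := ltn_ord i; case: ifP; [rewrite addKn|lia].
  by rewrite [blk w s o]blkE; case: ifP => //; lia.
have cE w y : store_block b (map val (enum 'I_k)) (fun=> 0) (upd (blk w s) o (s o + y)) =
    upd s o (s o + y).
  apply/funext=> x; rewrite /store_block !updE blkE val_enum_ord mem_iota /=.
  case: eqP => [->|_]; first by case: ifP => //; lia.
  by case: ifP => [bx|]; [rewrite s0 //; lia|case: ifP => //; lia].
rewrite sem_cat; split.
  case=> t1 /gE[w gw ->]; rewrite sem_cat => -[t2 /fE[y fy ->]].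
  rewrite sem_rcat_clear cE => ->; exists y => //.
  by exists [tuple w (nat_of_ord i) | i < k]; split=> // i; rewrite tnth_mktuple.
case=> y [w [gw fy]] ->; pose w' x := nth 0 w x.
have wE : [tuple w' (nat_of_ord i) | i < k] = w.
  by apply: eq_from_tnth => i; rewrite tnth_mktuple (tnth_nth 0).
exists (blk w' s); first by apply/gE; exists w' => // i; rewrite /w' -tnth_nth.
rewrite sem_cat; exists (upd (blk w' s) o (s o + y)).
  by apply/fE; exists y; rewrite ?wE.
by rewrite sem_rcat_clear cE.
Qed.

Lemma compile_zero n : compile_spec (RZero n).
Proof.
move=> a o b s s' ab ob ao s0 /=; rewrite sem_eps; split=> [->|[_ -> ->]].
  by exists 0; rewrite // addn0 upd_id.
by rewrite addn0 upd_id.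
Qed.

Lemma compile_proj n (i : 'I_n) : compile_spec (RProj i).
Proof.
move=> a o b s s' ab ob ao s0 /=; have := ab i; have := ao i => ? ?.
rewrite sem_copy ?(s0 b) //; [|lia|lia].
split=> [->|[_ -> ->]]; last by rewrite tnth_mktuple.
by exists (s (a i)); rewrite ?tnth_mktuple.
Qed.

Lemma compile_succ : compile_spec RSucc.
Proof.
move=> a o b s s' ab ob ao s0 /=; have := ab ord0; have := ao ord0 => ? ?.
have E : upd (upd s o (s o + s (a ord0))) o (upd s o (s o + s (a ord0)) o).+1 =
    upd s o (s o + (s (a ord0)).+1).
  by apply/funext=> x; rewrite !updE eqxx addnS; case: eqP.
rewrite sem_cat; split.
  case=> t; rewrite sem_copy ?(s0 b) //; [|lia|lia].
  by move=> ->; rewrite sem_inc E => ->; exists (s (a ord0)).+1; rewrite ?argval_head.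
case=> y ->; rewrite argval_head => ->; exists (upd s o (s o + s (a ord0))).
  by rewrite sem_copy ?(s0 b) //; lia.
by rewrite sem_inc E.
Qed.

(** Register [b] holds the candidate and [b + 1] the value of [f] there. [Dec] allows repeating on
    positive values only and [Tst] leaving on 0 only, so the search ends exactly at the least
    zero. *)
Lemma compile_min n (f : recfun n.+1) : compile_spec f -> compile_spec (RMin f).
Proof.
move=> fP a o b s s' ab ob ao s0 /=; set eval := compile _ _ _ _.
set v := argval a s.
have evalE y t : sem eval (upd s b y) t <->
    exists2 u, computes f [tuple of y :: v] u & t = upd (upd s b y) (b + 1) u.
  rewrite fP; first last.
  - by move=> x bx; rewrite updE s0; [case: eqP => //; lia|lia].
  - by rewrite /cons_arg => i; case: unlift => [j|]; [have := ab j; lia|lia].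
  - by lia.
  - by rewrite /cons_arg => i; case: unlift => [j|]; [have := ab j; lia|lia].
  rewrite argval_cons [upd s b y b]updE eqxx [upd s b y (b + 1)]updE s0; last lia.
  rewrite (_ : argval a (upd s b y) = v) ?ifN ?addn0 //; first by lia.
  by apply: eq_argval => i; rewrite updE; have := ab i; case: eqP => //; lia.
set body := eval ;; _.
have nb : (b == b + 1) = false by lia.
have bodyE y t : sem body (upd s b y) t <->
    (exists u, computes f [tuple of y :: v] u.+1) /\ t = upd s b y.+1.
  have E u : upd (upd (upd (upd (upd s b y) (b + 1) u) (b + 1) u.-1) (b + 1) 0) b y.+1
           = upd s b y.+1.
    apply/funext=> x; rewrite !updE.
    by do !case: eqP => //; move=> *; rewrite s0 //; lia.
  rewrite sem_cat; split.
    case=> t1 /evalE[u fu ->]; rewrite sem_cat => -[t2]; rewrite sem_dec updE eqxx.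
    case=> u0 ->; rewrite sem_cat => -[t3]; rewrite sem_clear => ->.
    rewrite sem_inc !(updE, eqxx, nb) E => ->; split=> //; exists u.-1.
    by rewrite prednK.
  case=> -[u fu] ->; exists (upd (upd s b y) (b + 1) u.+1); first by apply/evalE; exists u.+1.
  rewrite sem_cat; eexists; first by rewrite sem_dec updE eqxx.
  rewrite sem_cat; eexists; first by rewrite sem_clear.
  by rewrite sem_inc !(updE, eqxx, nb) (E u.+1).
have sE : s = upd s b 0 by rewrite upd_id // s0.
have finE y : upd (upd (upd s b y) b 0) o (upd s b y o + upd s b y b) = upd s o (s o + y).
  have ob' : (o == b) = false by lia.
  apply/funext=> x; rewrite !(updE, eqxx, ob').
  by do !case: eqP => //; move=> ->; rewrite s0.
have tstE y : upd (upd s b y) (b + 1) 0 = upd s b y.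
  by rewrite upd_id // updE s0; [case: eqP => //; lia|lia].
rewrite sem_cat; split.
  (* Invariant of the search: [b] holds some y, and every smaller candidate gave a positive
     value. *)
  case=> t St; have {St}[y [-> fy]] : exists y, t = upd s b y /\
      forall z, z < y -> exists u, computes f [tuple of z :: v] u.+1.
    apply: (star_inv (P := fun t => exists y, t = upd s b y /\
      forall z, z < y -> exists u, computes f [tuple of z :: v] u.+1)) St.
      move=> _ t' [y [-> fy]] /bodyE[fu ->]; exists y.+1; split=> // z.
      by rewrite ltnS leq_eqVlt => /predU1P[->|/fy].
    by exists 0; split.
  rewrite sem_cat => -[t1 /evalE[u fu ->]]; rewrite sem_cat => -[t2].
  rewrite sem_tst updE eqxx => -[u0]; rewrite u0 tstE in fu * => ->.
  by rewrite sem_move_to ?finE => [->|]; [exists y|lia].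
case=> y [fy fz] ->.
exists (upd s b y).
  (* The search is rebuilt from its end, by induction on the number of iterations still to run. *)
  have: forall z, z <= y -> sem (Star body) (upd s b z) (upd s b y).
    move=> z zy; rewrite -(subKn zy); move: (y - z) (leq_subr z y).
    elim=> [|d IH] dy; first by rewrite subn0; exact: star_refl.
    apply: (star_step (t := upd s b (y - d))); last by apply: IH; lia.
    by apply/bodyE; rewrite -subSn //; split; [apply: fz; lia|].
  by move=> /(_ 0 (leq0n y)); rewrite -sE.
rewrite sem_cat; exists (upd s b y); first by apply/evalE; exists 0; rewrite ?tstE.
rewrite sem_cat; exists (upd s b y).
  by rewrite sem_tst updE s0; [split=> //; case: eqP => //; lia|lia].
by rewrite sem_move_to ?finE //; lia.
Qed.

(** Register [b] holds the recursion index, [b + 1] the current value, [b + 2] the next value and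
    [b + 3] the number of rounds left. *)
Lemma compile_prim n (f : recfun n) (g : recfun n.+2) :
  compile_spec f -> compile_spec g -> compile_spec (RPrim f g).
Proof.
move=> fP gP a o b s s' ab ob ao s0 /=.
set v := argval a s; set tl := tail_arg a.
set evalg := compile g _ _ _; set body := evalg ;; _.
set P := fix prim (i : nat) : nat -> Prop := _.
pose St j z c := upd (upd (upd s b j) (b + 1) z) (b + 3) c.
have tlb i : tl i < b by exact: ab.
have a0b := ab ord0; have a0o := ao ord0.
pose Q (t t' : store) :=
  exists2 y, computes g (argval (cons_arg b (cons_arg (b + 1) tl)) t) y
           & t' = upd (upd t (b + 1) y) b (t b).+1.
pose I (t : store) := (forall x, b + 4 <= x -> t x = 0) /\ t (b + 2) = 0.
have bodyE t t' : I t -> sem body t t' <-> Q t t'.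
  case=> t0 t2.
  have evalE u : sem evalg t u <->
      exists2 y, computes g (argval (cons_arg b (cons_arg (b + 1) tl)) t) y
               & u = upd t (b + 2) y.
    rewrite gP ?t2 //; last 1 first.
    - rewrite /cons_arg => i; case: unlift => [j|]; last lia.
      by case: unlift => [l|]; [have := tlb l; lia|lia].
    - rewrite /cons_arg => i; case: unlift => [j|]; last lia.
      by case: unlift => [l|]; [have := tlb l; lia|lia].
    - by lia.
  pose t3 y := upd (upd t (b + 2) y) (b + 1) 0.
  pose t4 y := upd (upd (t3 y) (b + 2) 0) (b + 1) (t3 y (b + 1) + t3 y (b + 2)).
  have E y : upd (t4 y) b (t4 y b).+1 = upd (upd t (b + 1) y) b (t b).+1.
    apply/funext=> x; rewrite /t4 /t3 !updE !eqxx.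
    have -> : (b == b + 1) = false by lia.
    have -> : (b == b + 2) = false by lia.
    have -> : (b + 2 == b + 1) = false by lia.
    by do !case: eqP => // *; rewrite ?t2 //; subst x; rewrite ?t2.
  have b21 : b + 2 != b + 1 by lia.
  rewrite sem_cat; split.
    case=> u /evalE[y gy ->]; rewrite sem_cat => -[u1]; rewrite sem_clear => ->.
    rewrite sem_cat => -[u2]; rewrite sem_move_to // => ->; rewrite sem_inc (E y) => ->.
    by exists y.
  case=> y gy ->; exists (upd t (b + 2) y); first by apply/evalE; exists y.
  rewrite sem_cat; exists (t3 y); first by rewrite sem_clear.
  rewrite sem_cat; exists (t4 y); first by rewrite sem_move_to.
  by rewrite sem_inc -E.
have loopE t t' : I t -> sem (loop (b + 3) body) t t' <->
    iter_rel (fun t => Q (upd t (b + 3) (t (b + 3)).-1)) (t (b + 3)) t t'.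
  apply: sem_loop => [u [u0 u2] _|//|u u' [u0 u2] [y _ ->]].
    by split=> [x bx|]; rewrite updE ifN; [exact: u0|lia|exact: u2|lia].
  split; last by rewrite !updE ifN ?ifN //; lia.
  by split=> [x bx|]; rewrite !updE ifN ?ifN; [exact: u0|lia|lia|exact: u2|lia|lia].
have StE j z c x : St j z c x =
    if x == b + 3 then c else if x == b + 1 then z else if x == b then j else s x by [].
have ISt j z c : I (St j z c).
  by split=> [x bx|]; rewrite StE !ifN; try apply: s0; lia.
have QSt j z c t : Q (St j z c) t <->
    exists2 y, computes g [tuple of j :: z :: behead v] y & t = St j.+1 y c.
  have vE : argval (cons_arg b (cons_arg (b + 1) tl)) (St j z c) =
      [tuple of j :: z :: behead v].
    rewrite argval_cons argval_cons (@eq_argval _ tl (St j z c) s); last first.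
      by move=> i; have := tlb i; rewrite StE => tb; rewrite !ifN //; lia.
    rewrite argval_tail; have -> : St j z c b = j by rewrite StE eqxx !ifN //; lia.
    have -> : St j z c (b + 1) = z by rewrite StE eqxx !ifN //; lia.
    exact: val_inj.
  have SE y : upd (upd (St j z c) (b + 1) y) b (St j z c b).+1 = St j.+1 y c.
    have -> : St j z c b = j by rewrite StE eqxx !ifN //; lia.
    apply/funext=> x; rewrite !updE !StE.
    by do !case: eqP => //; lia.
  by rewrite /Q vE; split=> -[y gy ->]; exists y; rewrite ?SE.
(* Generalized over the starting index: c rounds lead from the value at j to the value at j + c. *)
have iterE c j t :
    (exists2 z, P j z & iter_rel (fun t => Q (upd t (b + 3) (t (b + 3)).-1)) c (St j z c) t)
    <-> exists2 z, P (j + c) z & t = St (j + c) z 0.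
  elim: c j => [|c IH] j; first by rewrite addn0.
  have decE z : upd (St j z c.+1) (b + 3) (St j z c.+1 (b + 3)).-1 = St j z c.
    by apply/funext=> x; rewrite !updE !StE eqxx; case: eqP.
  rewrite (addnS j) -(addSn j) -IH; split.
    case=> z Pz /= [u]; rewrite decE => /QSt[y gy ->] H.
    by exists y => //; exists z.
  case=> y [z [Pz gy]] H; exists z => //=; exists (St j.+1 y c) => //.
  by rewrite decE; apply/QSt; exists y.
have fE t : sem (compile f tl (b + 1) (b + 4)) s t <->
    exists2 z, P 0 z & t = upd s (b + 1) z.
  rewrite fP; last first.
  - by move=> x bx; apply: s0; lia.
  - by move=> i; have := tlb i; lia.
  - by lia.
  - by move=> i; have := tlb i; lia.
  by rewrite argval_tail s0 //; lia.
have copyE z t : sem (copy (a ord0) (b + 3) (b + 2)) (upd s (b + 1) z) t <->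
    t = St 0 z (s (a ord0)).
  rewrite sem_copy; try lia; last by rewrite updE ifN ?s0 //; lia.
  suff -> : upd (upd s (b + 1) z) (b + 3) (upd s (b + 1) z (b + 3) + upd s (b + 1) z (a ord0))
    = St 0 z (s (a ord0)) by [].
  have -> : upd s (b + 1) z (b + 3) = 0 by rewrite updE ifN ?s0 //; lia.
  have -> : upd s (b + 1) z (a ord0) = s (a ord0) by rewrite updE ifN //; lia.
  apply/funext=> x; rewrite StE !updE add0n.
  by do !case: eqP => // *; subst x; rewrite s0.
have finE c z t : sem (move_to (b + 1) o ;; clear b) (St c z 0) t <-> t = upd s o (s o + z).
  have E : upd (upd (upd (St c z 0) (b + 1) 0) o (St c z 0 o + St c z 0 (b + 1))) b 0
      = upd s o (s o + z).
    apply/funext=> x; rewrite !updE !StE eqxx.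
    have -> : (b + 1 == b + 3) = false by lia.
    have -> : (o == b + 3) = false by lia.
    have -> : (o == b + 1) = false by lia.
    have -> : (o == b) = false by lia.
    by do !case: eqP => // *; subst x; rewrite ?s0 //; lia.
  rewrite sem_cat; split.
    by case=> u; rewrite sem_move_to; [move=> ->; rewrite sem_clear E|lia].
  move=> ->; eexists; first by rewrite sem_move_to //; lia.
  by rewrite sem_clear E.
have aE z c : St 0 z c (b + 3) = c by rewrite StE eqxx.
rewrite sem_cat argval_head; split.
  case=> t /fE[z0 P0 ->]; rewrite sem_cat => -[t1 /copyE ->].
  rewrite sem_cat => -[t2 /(loopE _ _ (ISt _ _ _))]; rewrite aE => it.
  have [] : exists2 z, P (0 + s (a ord0)) z & t2 = St (0 + s (a ord0)) z 0.
    by apply/iterE; exists z0.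
  by move=> z Pz -> /finE ->; exists z.
case=> z Pz ->.
have [|z0 P0 it] := (iterE (s (a ord0)) 0 (St (0 + s (a ord0)) z 0)).2; first by exists z.
exists (upd s (b + 1) z0); first by apply/fE; exists z0.
rewrite sem_cat; exists (St 0 z0 (s (a ord0))); first exact/copyE.
rewrite sem_cat; exists (St (s (a ord0)) z 0); last exact/finE.
by apply/(loopE _ _ (ISt _ _ _)); rewrite aE.
Qed.

Lemma compileP n (f : recfun n) : compile_spec f.
Proof.
elim: f => {n}.
- exact: compile_zero.
- exact: compile_succ.
- exact: compile_proj.
- by move=> k n f fP g gP; exact: compile_comp.
- by move=> n f fP g gP; exact: compile_prim.
- by move=> n f fP; exact: compile_min.
Qed.

(** * Counters in a rotating queue *)

(* [Mark] is a [Nop] that the formula can recognize; it ends the loading of the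
   input. The outputs of the last k phases, labeled [Flush], are not copied. *)
Inductive letter := Nop | Op (o : counter_op) | Mark | Flush.

Definition is_mark (l : letter) : bool := if l is Mark then true else false.
Definition is_flush (l : letter) : bool := if l is Flush then true else false.

Definition letter_rel (l : letter) (m n : nat) : Prop :=
  if l is Op o then op_rel o m n else m = n.

(** A letter pops the head of the queue, transforms it and appends the result at the tail. *)
Fixpoint qexec (w : seq letter) (q q' : seq nat) : Prop :=
  if w is l :: w' then
    exists m n q1, [/\ q = m :: q1, letter_rel l m n & qexec w' (rcons q1 n) q']
  else q' = q.

(** One full turn of a queue of length [k]: the first [Nop]s bring the register to the head, the
    last ones restore the order. *)
Definition instr_word (k : nat) (i : instr) : seq letter :=
  nseq i.2 Nop ++ Op i.1 :: nseq (k - i.2.+1) Nop.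

Arguments instr_word : simpl never.

Lemma qexec_cat w1 w2 q q' :
  qexec (w1 ++ w2) q q' <-> exists2 t, qexec w1 q t & qexec w2 t q'.
Proof.
elim: w1 q => [|l w1 IH] q /=; first by split=> [H|[t ->]] //; exists q.
split; first by case=> m [n [q1 [-> L /IH[t E1 E2]]]]; exists t => //; exists m, n, q1.
by case=> t [m [n [q1 [-> L E1]]]] E2; exists m, n, q1; split=> //; apply/IH; exists t.
Qed.

Lemma qexec_nop q1 q2 q' : qexec (nseq (size q1) Nop) (q1 ++ q2) q' <-> q' = q2 ++ q1.
Proof.
elim: q1 q2 => [|m q1 IH] q2 /=; first by rewrite cats0.
rewrite -cat_rcons -IH; split.
  by case=> _ [n [_ [[<- <-] <-]]]; rewrite rcons_cat.
by move=> H; exists m, m, (q1 ++ q2); rewrite rcons_cat.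
Qed.

Lemma qexec_nop_round q q' : qexec (nseq (size q) Nop) q q' <-> q' = q.
Proof. by have := qexec_nop q [::] q'; rewrite cats0. Qed.

Lemma mkseq_split (s : store) k r : r < k ->
  mkseq s k = mkseq s r ++ s r :: mkseq (fun x => s (r.+1 + x)) (k - r.+1).
Proof.
move=> rk; have E : k = r + (k - r.+1).+1 by lia.
rewrite {1}E /mkseq iotaD map_cat /=; congr (_ ++ _ :: _).
by rewrite add0n -[X in iota X _](addn0 r.+1) iotaDl -map_comp.
Qed.

Lemma eq_mkseqn (s s' : store) k : (forall x, x < k -> s x = s' x) -> mkseq s k = mkseq s' k.
Proof. by move=> E; apply/eq_in_map => x; rewrite mem_iota => /E. Qed.

Lemma qexec_instr k i s q' : i.2 < k ->
  qexec (instr_word k i) (mkseq s k) q' <-> exists2 s', instr_rel i s s' & q' = mkseq s' k.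
Proof.
case: i => o r /= rk; rewrite /instr_word /instr_rel qexec_cat /= (mkseq_split s rk).
have updk n : mkseq (upd s r n) k =
    mkseq s r ++ n :: mkseq (fun x => s (r.+1 + x)) (k - r.+1).
  rewrite (mkseq_split _ rk) updE eqxx; congr (_ ++ _ :: _).
    by apply: eq_mkseqn => x xr; rewrite updE ifN //; lia.
  by apply: eq_mkseqn => x xr; rewrite updE ifN //; lia.
have nopE q1 q2 n t : size q1 = n -> qexec (nseq n Nop) (q1 ++ q2) t <-> t = q2 ++ q1.
  by move=> <-; exact: qexec_nop.
split.
  case=> t; rewrite nopE ?size_mkseq // => -> [m [n [q1 [[<- <-] on]]]].
  rewrite -cats1 -catA nopE ?size_mkseq // -catA => ->.
  by exists (upd s r n); [exists n|rewrite updk].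
case=> _ [n on ->] ->; eexists; first by rewrite nopE ?size_mkseq.
exists (s r), n; eexists; split=> //.
by rewrite -cats1 -catA nopE ?size_mkseq // updk -catA.
Qed.

Lemma qexec_word k w s q' : List.Forall (fun i : instr => i.2 < k) w ->
  qexec (flatten (map (instr_word k) w)) (mkseq s k) q' <->
  exists2 s', exec w s s' & q' = mkseq s' k.
Proof.
move=> F; elim: F s => {w} [|i w ik _ IH] s /=; first by split=> [->|[_ -> ->]] //; exists s.
rewrite qexec_cat; split.
  case=> _ /(qexec_instr _ _ ik)[t it ->] /IH[s' es ->].
  by exists s' => //; exists t.
case=> s' [t it es] qE; exists (mkseq t k); first by apply/(qexec_instr _ _ ik); exists t.
by apply/IH; exists s'.
Qed.

(** Programs begin with such tests: in the real encoding they force the first k inputs to code 0. *)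
Lemma qexec_tst n k q' : 0 < k ->
  qexec (nseq n (Op Tst)) (nseq k 0) q' <-> q' = nseq k 0.
Proof.
case: k => // k _; elim: n => [|n IH] //=; rewrite -IH.
have E : rcons (nseq k 0) 0 = nseq k.+1 0 by rewrite -cats1 -(nseqD k 1) addn1.
split; first by case=> m [l [q1 [[<- <-] [_ ->]]]]; rewrite E.
by move=> H; exists 0, 0, (nseq k 0); rewrite E.
Qed.

Fixpoint max_reg (e : regex instr) : nat :=
  match e with
  | Eps => 0
  | Sym i => i.2
  | e1 ;; e2 => maxn (max_reg e1) (max_reg e2)
  | Star e1 => max_reg e1
  end.

Lemma lang_max_reg e w k : max_reg e < k -> lang e w -> List.Forall (fun i : instr => i.2 < k) w.
Proof.
elim: e w => [|i|e1 IH1 e2 IH2|e IH] w /=.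
- by move=> _ ->; constructor.
- by move=> ik ->; constructor=> //; constructor.
- rewrite gtn_max => /andP[k1 k2] [w1 [w2 [-> /IH1 F1 /IH2 F2]]].
  by apply/List.Forall_app; split; [exact: F1|exact: F2].
- move=> ek [ws F ->]; elim: F => {ws} [|v ws Lv _ F] /=; first by constructor.
  by apply/List.Forall_app; split=> //; exact: IH.
Qed.

(** * The word of a program and its input *)

Section Program.

Variable h : recfun 2.

Definition main : regex instr :=
  compile h (@nat_of_ord 2) 2 3 ;; Sym (Tst, 2).

(** The maximum with 2 guarantees the registers 0, 1 and 2, which hold the input, the number of
    registers and the value of [h]. *)
Definition nreg : nat := (maxn 2 (max_reg main)).+1.

Arguments nreg : simpl never.

(* The number of registers is passed as a second argument because the formula,
   and thus its code, depends on it. *)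
Definition program : regex letter :=
  rword (nseq nreg.-1 (Op Tst)) ;;
  Star (rword (instr_word nreg (Inc, 0))) ;;
  rword (Mark :: nseq nreg.-1 Nop) ;;
  rsubst (fun i => rword (instr_word nreg i)) (rword (nseq nreg (Inc, 1)) ;; main) ;;
  rword (nseq nreg Flush).

(** The letters before the flush: [m] is the number of loading turns chosen by the star, [w] a word
    of [main]. *)
Definition body_word (m : nat) (w : seq instr) : seq letter :=
  nseq nreg (Op Tst) ++ flatten (nseq m (instr_word nreg (Inc, 0))) ++
  (Mark :: nseq nreg.-1 Nop) ++
  flatten (map (instr_word nreg) (nseq nreg (Inc, 1) ++ w)).

Lemma lang_star_rword T (u w : seq T) :
  lang (Star (rword u)) w <-> exists m, w = flatten (nseq m u).
Proof.
split.
  case=> ws F ->; elim: F => {ws} [|v ws /lang_rword -> _ [m IH]]; first by exists 0.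
  by exists m.+1; rewrite /= IH.
case=> m ->; exists (nseq m u) => //.
by elim: m => [|m IH] /=; constructor=> //; apply/lang_rword.
Qed.

(** The leading [Sym (Op Tst)] supplies the first of the [nreg] tests; kept apart, it is the single
    position where the automaton starts. *)
Lemma lang_program u :
  lang (Sym (Op Tst) ;; program) u <->
  exists m w, lang main w /\ u = body_word m w ++ nseq nreg Flush.
Proof.
have cat1 (T : Type) (a : seq T) e v : lang (rword a ;; e) v <->
    exists2 v', v = a ++ v' & lang e v'.
  split; first by case=> w1 [w2 [-> /lang_rword -> L]]; exists w2.
  by case=> v' -> L; exists a, v'; split=> //; apply/lang_rword.
have lang_cat (T : Type) (e1 e2 : regex T) v : lang (e1 ;; e2) v <->
    exists w1 w2, [/\ v = w1 ++ w2, lang e1 w1 & lang e2 w2] by [].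
rewrite lang_cat /program; split.
  case=> w1 [w2 [-> -> /cat1[w3 -> /lang_cat]]].
  case=> w4 [w5 [-> /lang_star_rword[m ->] /cat1[w6 -> /lang_cat]]].
  case=> w7 [w8 [-> /lang_rsubst_word[w9 /cat1[w10 -> Lw] ->] /lang_rword ->]].
  exists m, w10; split=> //; by rewrite /body_word -!catA.
case=> m [w [Lw ->]].
pose w4 := flatten (map (instr_word nreg) (nseq nreg (Inc, 1) ++ w)) ++ nseq nreg Flush.
pose w3 := flatten (nseq m (instr_word nreg (Inc, 0))) ++ (Mark :: nseq nreg.-1 Nop) ++ w4.
exists [:: Op Tst], (nseq nreg.-1 (Op Tst) ++ w3).
split=> //; first by rewrite /body_word /w3 /w4 -!catA.
apply/cat1; exists w3 => //; apply/lang_cat.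
eexists _, _; split; [by []|by apply/lang_star_rword; exists m|].
apply/cat1; exists w4 => //; apply/lang_cat.
eexists _, _; split; [by []| |exact/lang_rword].
by apply/lang_rsubst_word; eexists; last by []; apply/cat1; exists w.
Qed.

(** The position of the mark, which the formula can prescribe through the cost, reveals the number
    of loading turns. *)
Definition accepted (n : nat) (m : nat) (w : seq instr) : Prop :=
  exists2 q, qexec (body_word m w) (nseq nreg 0) q & nth Nop (body_word m w) (nreg * n.+1) = Mark.

Lemma has_instr_words (b : pred letter) w : b Nop = false -> (forall o, b (Op o) = false) ->
  has b (flatten (map (instr_word nreg) w)) = false.
Proof.
move=> bN bO; elim: w => //= i w IH.
by rewrite has_cat IH orbF /instr_word has_cat /= !has_nseq bN bO !andbF.
Qed.

Lemma size_instr_word i : i.2 < nreg -> size (instr_word nreg i) = nreg.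
Proof. by move=> ik; rewrite size_cat /= !size_nseq; lia. Qed.

Lemma flatten_nseq_word m : flatten (nseq m (instr_word nreg (Inc, 0))) =
  flatten (map (instr_word nreg) (nseq m (Inc, 0))).
Proof. by rewrite map_nseq. Qed.

(** The word has a single mark, preceded by [nreg] tests and [m] instruction words of length
    [nreg]. *)
Lemma mark_position n m w :
  nth Nop (body_word m w) (nreg * n.+1) = Mark <-> m = n.
Proof.
rewrite /body_word flatten_nseq_word cat_cons; set u := flatten (map _ (nseq m _)).
have su : size u = nreg * m.
  rewrite /u; elim: (m) => [|m' IH]; first by rewrite muln0.
  rewrite -[flatten _]/(instr_word nreg (Inc, 0) ++
    flatten (map (instr_word nreg) (nseq m' (Inc, 0)))).
  by rewrite size_cat IH size_instr_word // mulnS.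
set v := _ ++ flatten _.
have hv : has is_mark v = false by rewrite has_cat has_instr_words // has_nseq andbF.
have hu : has is_mark (nseq nreg (Op Tst) ++ u) = false.
  by rewrite has_cat has_instr_words // has_nseq andbF.
rewrite catA nth_cat size_cat size_nseq su -mulnS.
split; last by move=> ->; rewrite ltnn subnn.
have notload x i : has is_mark x = false -> nth Nop x i <> Mark.
  move=> hx E; case: (ltnP i (size x)) => ix; last by rewrite nth_default in E.
  by move: hx => /negbT; rewrite -all_predC => /(all_nthP Nop) /(_ i ix); rewrite /= E.
case: ltnP => [_ /(notload _ _ hu)//|le].
case D: (_ - _) => [|d]; last by move=> /= /(notload _ _ hv).
by move=> _; move: D le; rewrite /nreg; nia.
Qed.

Lemma exec_nseq_inc m r s s' : exec (nseq m (Inc, r)) s s' <-> s' = upd s r (s r + m).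
Proof.
elim: m s s' => [|m IH] s s' /=; first by rewrite addn0 upd_id.
have E : upd (upd s r (s r).+1) r (upd s r (s r).+1 r + m) = upd s r (s r + m.+1).
  by apply/funext=> x; rewrite !updE eqxx addSnnS; case: eqP.
split; first by case=> t [n /= -> ->] /IH ->.
by move=> ->; exists (upd s r (s r).+1); [exists (s r).+1|apply/IH].
Qed.

(** The n loading turns put n in register 0, the next [nreg] turns put [nreg] in register 1, and
    [main] completes exactly when [h] has value 0 there. *)
Lemma accepted_computes n :
  (exists m w, lang main w /\ accepted n m w) <-> computes h [tuple n; nreg] 0.
Proof.
have k0 : 0 < nreg by [].
have zE : nseq nreg 0 = mkseq (fun=> 0) nreg.
  have E i j : [seq 0 | _ <- iota i j] = nseq j 0 by elim: j i => //= j IH i; rewrite IH.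
  by rewrite /mkseq E.
pose s0 : store := upd (upd (fun=> 0) 0 n) 1 nreg.
have runE w q : lang main w -> qexec (body_word n w) (nseq nreg 0) q <->
    exists2 s', exec w s0 s' & q = mkseq s' nreg.
  move=> Lw; have Fw : List.Forall (fun i : instr => i.2 < nreg) w.
    by apply: lang_max_reg Lw; rewrite ltnS leq_maxr.
  have Fi m r : r < nreg -> List.Forall (fun i : instr => i.2 < nreg) (nseq m (Inc, r)).
    by move=> rk; elim: m => [|m IH] /=; constructor.
  have n1 : 1 < nreg by rewrite ltnS leq_max.
  have incE m r s t : r < nreg ->
      qexec (flatten (map (instr_word nreg) (nseq m (Inc, r)))) (mkseq s nreg) t <->
      t = mkseq (upd s r (s r + m)) nreg.
    move=> rk; rewrite (qexec_word _ _ (Fi m r rk)); split=> [[s' /exec_nseq_inc -> ->]|->] //.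
    by exists (upd s r (s r + m)) => //; apply/exec_nseq_inc.
  have loadE s t : qexec (Mark :: nseq nreg.-1 Nop) (mkseq s nreg) t <-> t = mkseq s nreg.
    by have := qexec_nop_round (mkseq s nreg) t; rewrite size_mkseq.
  rewrite /body_word qexec_cat; split.
    case=> t1 /(qexec_tst _ _ k0) ->; rewrite flatten_nseq_word qexec_cat zE => -[t2].
    rewrite incE // => ->; rewrite qexec_cat => -[t3]; rewrite loadE => ->.
    rewrite map_cat flatten_cat qexec_cat => -[t4]; rewrite incE // => ->.
    by rewrite (qexec_word _ _ Fw).
  move=> H; exists (nseq nreg 0); first exact/(qexec_tst _ _ k0).
  rewrite flatten_nseq_word qexec_cat zE; eexists; first by rewrite incE.
  rewrite qexec_cat; eexists; first by rewrite loadE.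
  rewrite map_cat flatten_cat qexec_cat; eexists; first by rewrite incE.
  by rewrite (qexec_word _ _ Fw).
have semE s' : sem main s0 s' <-> computes h [tuple n; nreg] 0 /\ s' = s0.
  rewrite /main sem_cat.
  have upd2 y : upd s0 2 (s0 2 + y) 2 = y by rewrite updE eqxx.
  have argE : argval (@nat_of_ord 2) s0 = [tuple n; nreg].
    apply: eq_from_tnth => i; rewrite tnth_mktuple.
    by case: i => -[|[|i]] //= ilt; rewrite (tnth_nth 0).
  have cE t : sem (compile h (@nat_of_ord 2) 2 3) s0 t <->
      exists2 y, computes h [tuple n; nreg] y & t = upd s0 2 (s0 2 + y).
    rewrite compileP ?argE //; last 1 first.
    - by move=> x x3; rewrite /s0 !updE !ifN //; lia.
    - by move=> i; exact: ltnW (ltn_ord i).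
    - by move=> i; have := ltn_ord i; lia.
  split.
    case=> t /cE[y hy ->]; rewrite sem_tst upd2 => -[y0 ->].
    by subst y; split=> //; apply: upd_id.
  case=> h0 ->; exists s0; first by apply/cE; exists 0; rewrite // upd_id.
  by rewrite sem_tst.
split.
  case=> m [w [Lw [q Q /mark_position mn]]]; subst m.
  have [s' es _] := (runE _ _ Lw).1 Q.
  by have [] : computes h [tuple n; nreg] 0 /\ s' = s0; [apply/semE; exists w|].
move=> h0; have [w Lw es] : sem main s0 s0 by apply/semE.
exists n, w; split=> //; exists (mkseq s0 nreg); last by apply/mark_position.
by apply/(runE _ _ Lw); exists s0.
Qed.

End Program.

Import Order.TTheory GRing.Theory Num.Theory.

(** * Real encoding of counters *)

Section Reals.

Variable R : realType.

Definition encode (n : nat) : R := (2^-1 ^+ n)%R.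

Lemma encodeS n : (encode n.+1 * 2 = encode n)%R.
Proof. by rewrite /encode exprSr mulfVK // pnatr_eq0. Qed.

Lemma encode_gt0 n : (0 < encode n)%R.
Proof. by rewrite exprn_gt0 // invr_gt0. Qed.

Lemma encode_le1 n : (encode n <= 1)%R.
Proof. by rewrite /encode; apply: exprn_ile1; rewrite ?invr_ge0 ?ler0n ?invf_le1 ?ltr0n ?ler1n. Qed.

Lemma encode_eq1 n : (encode n = 1)%R -> n = 0.
Proof.
case: n => // n E; suff: (encode n.+1 < 1)%R by rewrite E ltxx.
by have := encodeS n; have := encode_le1 n; have := encode_gt0 n; lra.
Qed.

(** The equations imposed by cost 2: a phase costs x + (1 - y) + (1 - y), plus x for [Dec], plus y
    except for [Inc]. For [Tst] a guard adds x = 1. *)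
Definition letter_real (l : letter) (x y : R) : Prop :=
  match l with
  | Op Inc => (y * 2 = x)%R
  | Op Dec => (y = x * 2)%R
  | Op Tst => (x = 1)%R /\ y = x
  | _ => y = x
  end.

(** The bound on [y] makes [Dec] block on the counter 0, where x = 1 would give y = 2. *)
Lemma letter_real_encode l m (y : R) : (y <= 1)%R ->
  letter_real l (encode m) y <-> exists2 n, letter_rel l m n & y = encode n.
Proof.
move=> y1; case: l => [|[]||] /=.
- by split=> [->|[_ <- ->]] //; exists m.
- split=> [E|[_ -> ->]]; last exact: encodeS.
  by exists m.+1 => //; have := encodeS m; lra.
- split=> [E|[n -> ->]]; last by rewrite encodeS.
  case: m E => [|m] E; last by exists m; rewrite // E encodeS.
  by move: y1; rewrite E /encode expr0; lra.
- split=> [[/encode_eq1 -> ->]|[_ [-> ->] ->]]; last by rewrite /encode expr0.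
  by exists 0.
- by split=> [->|[_ <- ->]] //; exists m.
- by split=> [->|[_ <- ->]] //; exists m.
Qed.

(** The inputs j, ..., j + k - 1 code the queue before the j-th letter; shifting [x] and [y] by one
    pops its head. *)
Lemma qexec_of_reals k w q (x y : nat -> R) : size q = k -> 0 < k ->
  (forall i, i < k -> x i = encode (nth 0 q i)) ->
  (forall j, j < size w ->
     [/\ (y j <= 1)%R, letter_real (nth Nop w j) (x j) (y j) & x (j + k) = y j]) ->
  exists q', qexec w q q'.
Proof.
move=> + k0; elim: w q x y => [|l w IH] q x y qk xq xw; first by exists q.
case: q qk xq => [|m q] qk xq; first by rewrite -qk in k0.
have [y1 lr xk] := xw 0 isT.
rewrite (xq 0 k0) in lr; have [n ln yn] := (letter_real_encode _ _ y1).1 lr.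
have [|i ik|j jw|q' qq'] := IH (rcons q n) (x \o S) (y \o S).
- by rewrite size_rcons.
- rewrite nth_rcons /= in qk *; case: ltngtP => [iq|iq|iq].
  + by rewrite xq ?ltnS //; lia.
  + by lia.
  + by rewrite -yn -xk; congr x; lia.
- by have := xw j.+1 jw; rewrite addSn.
by exists q', m, n, q.
Qed.

(** The last clause continues the sequences beyond the word with y = x, the equation of the flush
    phases. *)
Lemma reals_of_qexec k w q q' : size q = k -> 0 < k -> qexec w q q' ->
  exists x y : nat -> R,
  [/\ forall i, i < k -> x i = encode (nth 0 q i),
      forall j, (0 <= x j <= 1)%R /\ (0 <= y j <= 1)%R,
      forall j, j < size w -> letter_real (nth Nop w j) (x j) (y j) /\ x (j + k) = y j
    & forall j, size w <= j -> y j = x j].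
Proof.
move=> + k0; elim: w q => [|l w IH] q qk /=.
  move=> _; exists (fun i => encode (nth 0 q i)), (fun i => encode (nth 0 q i)).
  by split=> // j; rewrite encode_le1 (ltW (encode_gt0 _)).
case=> m [n [q1 [qE lmn qq']]]; subst q.
have [|x [y [xq x01 xw yx]]] := IH (rcons q1 n) _ qq'; first by rewrite size_rcons.
rewrite /= in qk.
exists (fun j => if j is i.+1 then x i else encode m).
exists (fun j => if j is i.+1 then y i else encode n).
split=> [[|i] ik|[|j]|[|j] jw|[|j] //] //.
- by rewrite /= xq ?nth_rcons; [rewrite ifT //; lia|lia].
- by rewrite !encode_le1 !(ltW (encode_gt0 _)).
- rewrite add0n -(prednK k0); split; last first.
    by rewrite xq ?nth_rcons; [rewrite ltnNge ifN ?ifT //; lia|lia].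
  by apply/letter_real_encode; [exact: encode_le1|exists n].
- exact: xw.
- exact: yx.
Qed.

(* [x j] and [y j] are the input and the output of the j-th phase. *)
Definition word_reals (k : nat) (w : seq letter) (x y : nat -> R) : Prop :=
  forall j, j < size w ->
  [/\ (0 <= x j <= 1)%R, (0 <= y j <= 1)%R, letter_real (nth Nop w j) (x j) (y j)
    & j + k < size w -> ~~ is_flush (nth Nop w j) -> x (j + k) = y j].

(** The leading tests pin the first k inputs to 1, the code of 0, and the flush provides the k
    phases that receive the last outputs. *)
Lemma word_realsP k w : 0 < k -> has is_flush w = false ->
  (exists x y, word_reals k ((nseq k (Op Tst) ++ w) ++ nseq k Flush) x y) <->
  exists q, qexec (nseq k (Op Tst) ++ w) (nseq k 0) q.
Proof.
move=> k0 wF; set u := nseq k (Op Tst) ++ w.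
have uF : has is_flush u = false by rewrite has_cat has_nseq wF andbF.
have su : size u = k + size w by rewrite size_cat size_nseq.
have nthu j : j < size u -> nth Nop (u ++ nseq k Flush) j = nth Nop u j.
  by move=> ju; rewrite nth_cat ju.
split.
  case=> x [y xy].
  apply: (qexec_of_reals (x := x) (y := y) (size_nseq k 0)) => // [i ik|j ju].
    have [] := xy i; first by rewrite size_cat size_nseq; lia.
    move=> _ _; rewrite nthu ?su; last by lia.
    by rewrite /u nth_cat size_nseq ik !nth_nseq ik /= => -[-> _].
  have [] := xy j; first by rewrite size_cat size_nseq; lia.
  move=> _ /andP[_ y1]; rewrite nthu // => lr xk; split=> //.
  apply: xk; first by rewrite size_cat size_nseq; lia.
  by move: uF => /negbT; rewrite -all_predC => /(all_nthP Nop) /(_ j ju).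
case=> q /(reals_of_qexec (size_nseq k 0) k0)[x [y [_ x01 xu yx]]].
exists x, y => j; rewrite size_cat size_nseq => ju; have [xj yj] := x01 j.
split=> //; last by move=> jk _; have [] := xu j; [lia|].
case: (ltnP j (size u)) => ju'; first by rewrite nthu //; have [] := xu j.
by rewrite nth_cat ltnNge ju' /= nth_nseq ifT ?yx //; lia.
Qed.

End Reals.

(** * The priced timed automaton *)

Section Automaton.

Variables (V : finType) (lab : V -> letter) (fol : rel V) (fin : pred V) (v0 : V).

(* Each node of the graph is a phase, which goes through 7 locations; [None] is the
   halting node. *)
Definition loc : finType := (option V * 'I_7)%type.

Definition loc_letter (l : loc) : letter := if l.1 is Some v then lab v else Nop.

Definition node_step (a b : option V) : bool :=
  match a, b with
  | Some x, Some y => fol x y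
  | Some x, None => fin x
  | None, _ => false
  end.

Definition loc_step (l l' : loc) : bool :=
  if l.2 < 6 then (l'.1 == l.1) && (l'.2 == l.2.+1 :> nat)
  else node_step l.1 l'.1 && (l'.2 == 0 :> nat).

Definition clock_x : 'I_2 := ord0.
Definition clock_y : 'I_2 := ord_max.

(** A free wait t followed by a reset of [clock_x] leaves t in [clock_y]. Waiting until this clock
    is 1 takes 1 - t and, after its reset, leaves 1 - t in the other clock, and so on alternately.
    Locations 0 to 2 do this for the input, 3 to 6 for the output. *)
Definition loc_guard (l : loc) : constr 2 :=
  match nat_of_ord l.2 with
  | 0 => CAtom clock_y (if loc_letter l is Op Tst then CEq else CLe) 1
  | 2 | 5 => CAtom clock_x CEq 1
  | 3 => CAtom clock_y CLe 1
  | _ => CAtom clock_y CEq 1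
  end.

Definition loc_resets (l : loc) : {set 'I_2} :=
  match nat_of_ord l.2 with
  | 0 | 3 | 5 => [set clock_x]
  | 1 | 4 => [set clock_y]
  | _ => setT
  end.

(* In a phase with input x and output y, the delays in the locations 0, .., 6 are
   x, 1 - x, x, y, 1 - y, y, 1 - y. *)
Definition loc_rate (l : loc) : nat :=
  match nat_of_ord l.2 with
  | 0 | 4 | 6 => 1
  | 2 => if loc_letter l is Op Dec then 1 else 0
  | 5 => if loc_letter l is Op Inc then 0 else 1
  | _ => 0
  end.

Definition ap_start : 'I_5 := @Ordinal 5 0 isT.
Definition ap_in : 'I_5 := @Ordinal 5 1 isT.
Definition ap_out : 'I_5 := @Ordinal 5 2 isT.
Definition ap_mark : 'I_5 := @Ordinal 5 3 isT.
Definition ap_halt : 'I_5 := @Ordinal 5 4 isT.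

(** When location 1 is entered the phase has cost x so far, and when location 6 is entered 1 - y is
    still to be paid; these are the two ends of a copy. *)
Definition loc_label (l : loc) : {set 'I_5} :=
  [set a : 'I_5 | match nat_of_ord a with
    | 0 => l.2 == 0 :> nat
    | 1 => l.2 == 1 :> nat
    | 2 => (l.2 == 6 :> nat) && ~~ is_flush (loc_letter l)
    | 3 => (l.2 == 0 :> nat) && is_mark (loc_letter l)
    | _ => (l.2 == 0 :> nat) && (l.1 == None)
    end].

Definition loc_edge (l l' : loc) : edge 2 #|loc| :=
  Edge (enum_rank l) (loc_guard l) (loc_resets l) (enum_rank l').

(** The invariant holds at all reachable valuations and transitions are free, so the cost comes from
    delays alone. *)
Definition automaton : pta 2 1 5 :=
  @PTA 2 1 5 #|loc| (enum_rank (Some v0, ord0) : 'I_#|loc|)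
    [seq loc_edge p.1 p.2 | p : loc * loc in [pred p | loc_step p.1 p.2]]
    (fun _ => CAtom clock_x CGe 0)
    (fun _ q => loc_rate (enum_val q))
    (fun _ _ => 0)
    (fun q => loc_label (enum_val q)).

Lemma automaton_stopwatch : stopwatch automaton ord0.
Proof.
move=> q /=; rewrite /loc_rate; move: (enum_val q) => l.
by case: (nat_of_ord _) => [|[|[|[|[|[|[|n]]]]]]]; case: (loc_letter l) => [|[]||].
Qed.

Lemma In_edges e :
  List.In e (edges automaton) <-> exists l l', loc_step l l' /\ e = loc_edge l l'.
Proof.
rewrite /=; set s := image _ _.
have mapP (U : eqType) (f : U -> edge 2 #|loc|) r :
    List.In e (map f r) <-> exists2 x, x \in r & e = f x.
  elim: r => [|x r IH] /=; first by split=> // -[].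
  split; first by case=> [<-|/IH[y yr ->]];
    [exists x; rewrite ?inE ?eqxx|exists y; rewrite ?inE ?yr ?orbT].
  by case=> y; rewrite inE => /predU1P[->|yr] eE; [left; rewrite eE|right; apply/IH; exists y].
rewrite /s /image_mem mapP; split.
  by case=> -[l l']; rewrite mem_enum inE /= => st ->; exists l, l'.
by case=> l [l' [st ->]]; exists (l, l') => //; rewrite mem_enum.
Qed.

(** * Runs as indexed traces *)

Variable R : realType.

Implicit Types (s : state R automaton) (r : seq (step R automaton)).

Definition nth_state s r t : state R automaton :=
  last s (map (@step_state R 2 1 5 automaton) (take t r)).

Lemma steps_cost_cat s r1 r2 :
  steps_cost ord0 s (r1 ++ r2) =
  (steps_cost ord0 s r1 + steps_cost ord0 (last s (map (@step_state R 2 1 5 automaton) r1)) r2)%R.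
Proof. by elim: r1 s => [|a r1 IH] s /=; rewrite ?add0r // IH !addrA. Qed.

Lemma nth_stateD s r i j : nth_state (nth_state s r i) (drop i r) j = nth_state s r (i + j).
Proof. by rewrite /nth_state takeD map_cat last_cat. Qed.

(** Satisfaction at position [t] of a fixed run with locations [l] and accumulated costs [C]:
    suffixes become indices, and costs of prefixes become differences. *)
Fixpoint tsat (n : nat) (l : nat -> loc) (C : nat -> R) (phi : wmtl 1 5) (t : nat) : Prop :=
  match phi with
  | WAtom a => a \in loc_label (l t)
  | WNot f => ~ tsat n l C f t
  | WOr f g => tsat n l C f t \/ tsat n l C g t
  | WUntil _ r c f g => exists u,
      [/\ t < u <= n, tsat n l C g u, (forall u', t < u' < u -> tsat n l C f u')
        & cmp_sem r (C u - C t)%R c%:R%R]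
  end.

Lemma modelsP s r phi t : t <= size r ->
  models (run_suffix (Run s r) t) phi <->
  tsat (size r) (fun i => enum_val (nth_state s r i).1)
    (fun i => steps_cost ord0 s (take i r)) phi t.
Proof.
have sufE i j : run_suffix (run_suffix (Run s r) i) j = run_suffix (Run s r) (i + j).
  by rewrite /run_suffix /= -/(nth_state s r i) -/(nth_state _ _ j) nth_stateD drop_drop addnC.
elim: phi t => [a|f IH|f IHf g IHg|j o c f IHf g IHg] t tr /=.
- by [].
- by rewrite IH.
- by rewrite IHf ?IHg.
- rewrite /run_length /= size_drop.
  have costE i : run_cost j (run_prefix (run_suffix (Run s r) t) i) =
      (steps_cost ord0 s (take (t + i) r) - steps_cost ord0 s (take t r))%R.
    by rewrite takeD steps_cost_cat addrC addKr [j]ord1.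
  split.
    case=> i [/andP[i0 ir]]; rewrite sufE costE => gi fi ci.
    have tir : t + i <= size r by lia.
    exists (t + i); split=> //; [by lia|exact/IHg|].
    move=> u tu; apply/IHf; first by lia.
    have := fi (u - t); rewrite sufE subnKC; last by lia.
    by apply; lia.
  case=> u [/andP[tu ur] gu fu cu]; exists (u - t).
  rewrite costE sufE subnKC; last by lia.
  split=> //; [by lia|exact/IHg|].
  move=> i' ii; rewrite sufE; apply/IHf; first by lia.
  by apply: fu; lia.
Qed.

Lemma valid_fromP a0 s r :
  valid_from s r <-> forall t, t < size r ->
  mixed_move (nth_state s r t) (step_delay (nth a0 r t))
    (step_edge (nth a0 r t)) (step_state (nth a0 r t)).
Proof.
elim: r s => [|a r IH] s //=; split.
  by case=> ma /IH va [|t] //; exact: va.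
by move=> H; split; [exact: (H 0)|apply/IH => t; exact: (H t.+1)].
Qed.

Definition trace n (l : nat -> loc) (v : nat -> valuation R 2) (d C : nat -> R) : Prop :=
  [/\ l 0 = (Some v0, ord0), v 0 = val0 R 2, C 0 = 0%R &
  forall t, t < n ->
  [/\ (0 <= d t)%R, loc_step (l t) (l t.+1),
      val_sat (val_shift (v t) (d t)) (loc_guard (l t)),
      v t.+1 = val_reset (val_shift (v t) (d t)) (loc_resets (l t))
    & C t.+1 = (C t + d t * (loc_rate (l t))%:R)%R]].

(** This gives the invariant of every location when a run is built from a trace. *)
Lemma trace_ge0 n l v d C t i : trace n l v d C -> t <= n -> (0 <= v t i)%R.
Proof.
case=> _ v00 _ tr; elim: t => [|t IH] tn; first by rewrite v00 ffunE.
have [d0 _ _ -> _] := tr t tn; rewrite !ffunE; case: ifP => // _.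
by rewrite addr_ge0 // IH // ltnW.
Qed.

Lemma has_model_trace (phi : wmtl 1 5) :
  (exists rho : run R automaton,
    [/\ is_run rho, run_first rho = init_state R automaton & models rho phi]) <->
  exists n l v d C, trace n l v d C /\ tsat n l C phi 0.
Proof.
split.
  case=> -[s r] [/= va sE mo]; subst s.
  set s := init_state R automaton in va mo *.
  pose a0 : step R automaton :=
    @Step R 2 1 5 automaton 0%R (loc_edge (Some v0, ord0) (Some v0, ord0)) s.
  exists (size r), (fun i => enum_val (nth_state s r i).1), (fun i => (nth_state s r i).2).
  exists (fun i => step_delay (nth a0 r i)), (fun i => steps_cost ord0 s (take i r)).
  split; last first.
    by apply/(modelsP _ _ (leq0n _)); rewrite /run_suffix take0 drop0.
  split.
  - by rewrite /nth_state take0 /= enum_rankK.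
  - by rewrite /nth_state take0.
  - by rewrite take0.
  - move=> t tr; have := (valid_fromP a0 s r).1 va t tr.
    have Et : nth_state s r t.+1 = step_state (nth a0 r t).
      by rewrite /nth_state (take_nth a0 tr) map_rcons last_rcons.
    rewrite -Et => -[s1 [d0 _ s1E] [eE srcE gE s'E _]].
    move: eE srcE gE s'E => /In_edges[l [l' [st ->]]] /= srcE gE s'E.
    rewrite s1E /= in srcE gE s'E.
    have lE : enum_val (nth_state s r t).1 = l by rewrite -srcE enum_rankK.
    rewrite lE s'E /= enum_rankK; split=> //.
    rewrite (take_nth a0 tr) -cats1 steps_cost_cat /= addr0 addr0.
    by rewrite -/(nth_state s r t) lE.
case=> n [l [v [d [C [tr ph]]]]]; have [l0 v00 C0 trs] := tr.
pose a t : step R automaton :=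
  @Step R 2 1 5 automaton (d t) (loc_edge (l t) (l t.+1)) (enum_rank (l t.+1), v t.+1).
pose r := mkseq a n; pose s : state R automaton := (enum_rank (l 0), v 0).
have szr : size r = n by rewrite size_mkseq.
have ntha t : t < n -> nth (a 0) r t = a t by move=> tn; rewrite nth_mkseq.
have SE t : t <= n -> nth_state s r t = (enum_rank (l t), v t).
  case: t => [|t] tn; first by rewrite /nth_state take0.
  by rewrite /nth_state (take_nth (a 0)) ?szr // map_rcons last_rcons ntha.
have cost1 s' t : steps_cost ord0 s' [:: a t] = (d t * (loc_rate (enum_val s'.1))%:R)%R.
  by rewrite /= !addr0.
have CE t : t <= n -> steps_cost ord0 s (take t r) = C t.
  elim: t => [|t IH] tn; first by rewrite take0 C0.
  rewrite (take_nth (a 0)) ?szr // -cats1 steps_cost_cat IH; last exact: ltnW.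
  rewrite -/(nth_state s r t) (SE _ (ltnW tn)) (ntha _ tn) cost1 enum_rankK.
  by have [_ _ _ _ ->] := trs t tn.
(* Satisfaction looks only at positions up to [n], where the constructed run agrees with the
   trace. *)
have tsatE psi t : t <= n ->
    tsat n (fun i => enum_val (nth_state s r i).1) (fun i => steps_cost ord0 s (take i r)) psi t <->
    tsat n l C psi t.
  elim: psi t => [b|f IH|f IHf g IHg|j o c f IHf g IHg] t tn /=.
  - by rewrite SE // enum_rankK.
  - by rewrite IH.
  - by rewrite IHf ?IHg.
  - split=> -[u [/andP[tu un] gu fu cu]]; exists u; split.
    + by rewrite tu.
    + exact/IHg.
    + by move=> u' uu; apply/IHf; [lia|exact: fu].
    + by rewrite -!CE.
    + by rewrite tu.
    + exact/IHg.
    + by move=> u' uu; apply/IHf; [lia|exact: fu].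
    + by rewrite !CE.
exists (Run s r); split.
- apply/(valid_fromP (a 0)) => t; rewrite szr => tn; rewrite SE ?ntha //=; last exact: ltnW.
  have [d0 st gt vt Ct] := trs t tn.
  exists (enum_rank (l t), val_shift (v t) (d t)).
    split=> //= u /andP[u0 _]; rewrite ffunE addr_ge0 //.
    by apply: trace_ge0 tr _; exact: ltnW.
  split=> //=; first by apply/In_edges; exists (l t), (l t.+1).
    by rewrite vt.
  exact: trace_ge0 tr _.
- by rewrite /= /s l0 v00.
- have := (modelsP s phi (leq0n (size r))).2; rewrite /run_suffix take0 drop0 /=; apply.
  by rewrite szr; apply/tsatE.
Qed.

End Automaton.

(** * The formula and the phases of a run *)

Definition wtrue : wmtl 1 5 := WOr (WAtom 1 ap_start) (WNot (WAtom 1 ap_start)).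

Definition wand (f g : wmtl 1 5) : wmtl 1 5 := WNot (WOr (WNot f) (WNot g)).

(** The left argument of the until makes its witness the very next phase start; the halting node is
    exempt. *)
Definition phase_formula : wmtl 1 5 :=
  WOr (WAtom 1 ap_halt) (WOr (WNot (WAtom 1 ap_start))
    (WUntil ord0 CEq 2 (WNot (WAtom 1 ap_start)) (WAtom 1 ap_start))).

(** From the out of phase j to the in of phase j + k, with input x', the cost is (1 - y) + 2(k - 1)
    + x', which is 2k - 1 exactly when x' = y. *)
Definition copy_formula (k : nat) : wmtl 1 5 :=
  WOr (WNot (WAtom 1 ap_out)) (WUntil ord0 CEq (k + k).-1 wtrue (WAtom 1 ap_in)).

Definition safe_formula (k : nat) : wmtl 1 5 := wand phase_formula (copy_formula k).

(** The until is strict, so [safe_formula] is required at position 0 separately. The bound [CGe 0]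
    holds for every prefix, so the other two untils express plain eventuality. *)
Definition formula (k c : nat) : wmtl 1 5 :=
  wand
    (wand (WUntil ord0 CEq c wtrue (WAtom 1 ap_mark))
          (WUntil ord0 CGe 0 wtrue (WAtom 1 ap_halt)))
    (wand (safe_formula k)
          (WNot (WUntil ord0 CGe 0 wtrue (WNot (safe_formula k))))).

Section Phases.

Variables (V : finType) (lab : V -> letter) (fol : rel V) (fin : pred V) (v0 : V).
Variable R : realType.

Notation loc := (loc V).
Notation trace := (@trace V lab fol fin v0 R).
Notation tsat := (@tsat V lab R).

Lemma in_start (l : loc) : (ap_start \in loc_label lab l) = (l.2 == 0 :> nat).
Proof. by rewrite inE. Qed.

Lemma in_in (l : loc) : (ap_in \in loc_label lab l) = (l.2 == 1 :> nat).
Proof. by rewrite inE. Qed.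

Lemma in_out (l : loc) : (ap_out \in loc_label lab l) =
  (l.2 == 6 :> nat) && ~~ is_flush (loc_letter lab l).
Proof. by rewrite inE. Qed.

Lemma in_mark (l : loc) : (ap_mark \in loc_label lab l) =
  (l.2 == 0 :> nat) && is_mark (loc_letter lab l).
Proof. by rewrite inE. Qed.

Lemma in_halt (l : loc) : (ap_halt \in loc_label lab l) = (l.2 == 0 :> nat) && (l.1 == None).
Proof. by rewrite inE. Qed.

Lemma tsat_wand n l C f g t : tsat n l C (wand f g) t <-> tsat n l C f t /\ tsat n l C g t.
Proof.
rewrite /wand /=; split=> [H|[hf hg] [|] //].
by split; apply: contrapT => nf; apply: H; [left|right].
Qed.

Lemma trace_cost_le n l v d C t u : trace n l v d C -> t <= u <= n -> (C t <= C u)%R.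
Proof.
case=> _ _ _ tr /andP[/subnKC <-]; elim: (u - t) => [|i IH] un; first by rewrite addn0.
rewrite addnS in un *; have [d0 _ _ _ ->] := tr _ un.
apply: le_trans (IH (ltnW un)) _.
by rewrite lerDl mulr_ge0.
Qed.

Definition phases_ok n (l : nat -> loc) (C : nat -> R) : Prop :=
  forall t, t <= n -> (l t).2 = 0 :> nat -> (l t).1 <> None ->
  exists u, [/\ t < u <= n, (l u).2 = 0 :> nat,
    (forall u', t < u' < u -> (l u').2 <> 0 :> nat) & (C u - C t = 2)%R].

Definition copies_ok n k (l : nat -> loc) (C : nat -> R) : Prop :=
  forall t, t <= n -> (l t).2 = 6 :> nat -> ~~ is_flush (loc_letter lab (l t)) ->
  exists u, [/\ t < u <= n, (l u).2 = 1 :> nat & (C u - C t = ((k + k).-1)%:R)%R].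

Lemma tsat_phase n l C t :
  tsat n l C phase_formula t <-> ((l t).2 = 0 :> nat -> (l t).1 <> None ->
  exists u, [/\ t < u <= n, (l u).2 = 0 :> nat,
    (forall u', t < u' < u -> (l u').2 <> 0 :> nat) & (C u - C t = 2)%R]).
Proof.
rewrite /phase_formula /= in_start in_halt; split.
  move=> H l0 lN; case: H; first by case/andP=> _ /eqP.
  case; first by rewrite l0.
  case=> u [tu su nu /eqP cu]; exists u; rewrite in_start in su.
  split=> //; first exact/eqP.
  by move=> u' /nu; rewrite in_start => nu' /eqP.
move=> H; case: (eqVneq (nat_of_ord (l t).2) 0) => [l0|_]; last by right; left.
case: (eqVneq (l t).1 None) => [_|/eqP lN]; [by left|right; right].
have [u [tu su nu cu]] := H l0 lN; exists u; split=> //; last exact/eqP.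
  by rewrite in_start su.
by move=> u' /nu; rewrite in_start => nu' /eqP.
Qed.

Lemma tsat_copy n k l C t :
  tsat n l C (copy_formula k) t <->
  ((l t).2 = 6 :> nat -> ~~ is_flush (loc_letter lab (l t)) ->
  exists u, [/\ t < u <= n, (l u).2 = 1 :> nat & (C u - C t = ((k + k).-1)%:R)%R]).
Proof.
rewrite /copy_formula /= in_out; split.
  move=> H l6 nf; case: H; first by rewrite l6 nf.
  case=> u [tu su _ /eqP cu].
  by exists u; rewrite in_in in su; split=> //; exact/eqP.
move=> H; case: (eqVneq (nat_of_ord (l t).2) 6) => [l6|]; last by left.
case nf: (is_flush _); [by left|right].
have [|u [tu su cu]] := H l6; first by rewrite nf.
exists u; split=> //; last exact/eqP.
  by rewrite in_in su.
by move=> u' _; exact: EM.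
Qed.

Lemma tsat_formula n l v d C k c : trace n l v d C ->
  tsat n l C (formula k c) 0 <->
  [/\ exists u, [/\ 0 < u <= n, (l u).2 = 0 :> nat, is_mark (loc_letter lab (l u)) & C u = c%:R%R],
      exists u, [/\ 0 < u <= n, (l u).2 = 0 :> nat & (l u).1 = None],
      phases_ok n l C & copies_ok n k l C].
Proof.
move=> tr; have C0 : C 0 = 0%R by case: tr.
have loadE : tsat n l C (WUntil ord0 CEq c wtrue (WAtom 1 ap_mark)) 0 <->
    exists u, [/\ 0 < u <= n, (l u).2 = 0 :> nat, is_mark (loc_letter lab (l u)) & C u = c%:R%R].
  rewrite /=; split=> -[u].
    rewrite in_mark C0 subr0 => -[u0 /andP[/eqP l0 ld] _ /eqP cu].
    by exists u.
  case=> u0 l0 ld cu; exists u; rewrite in_mark C0 subr0 l0 ld cu; split=> //.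
  by move=> *; exact: EM.
have haltE : tsat n l C (WUntil ord0 CGe 0 wtrue (WAtom 1 ap_halt)) 0 <->
    exists u, [/\ 0 < u <= n, (l u).2 = 0 :> nat & (l u).1 = None].
  rewrite /=; split=> -[u].
    by rewrite in_halt => -[u0 /andP[/eqP l0 /eqP lN] _ _]; exists u.
  case=> u0 l0 lN; exists u; rewrite in_halt l0 lN; split=> //.
    by move=> *; exact: EM.
  by rewrite subr_ge0; apply: trace_cost_le tr _; case/andP: u0.
have safeE : tsat n l C (wand (safe_formula k)
    (WNot (WUntil ord0 CGe 0 wtrue (WNot (safe_formula k))))) 0 <->
    phases_ok n l C /\ copies_ok n k l C.
  rewrite tsat_wand; split.
    case=> s0 sG; have S t : t <= n -> tsat n l C (safe_formula k) t.
      case: t => // t tn; apply: contrapT => ns; apply: sG.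
      exists t.+1; split=> //; first by move=> *; exact: EM.
      by rewrite /= subr_ge0; apply: trace_cost_le tr _.
    by split=> t /S /tsat_wand[/tsat_phase ? /tsat_copy ?].
  case=> P K; have S t : t <= n -> tsat n l C (safe_formula k) t.
    by move=> tn; apply/tsat_wand; split; [apply/tsat_phase; exact: P|apply/tsat_copy; exact: K].
  by split; [exact: S|case=> u [/andP[_ un] nS _ _]; apply: nS; exact: S].
rewrite /formula tsat_wand safeE tsat_wand loadE haltE.
by split=> [[[? ?] []]|[]].
Qed.

Lemma trace_index n l v d C t : trace n l v d C -> t <= n -> (l t).2 = t %% 7 :> nat.
Proof.
case=> l0 _ _ tr; elim: t => [|t IH] tn; first by rewrite l0.
have [_ st _ _ _] := tr t tn; move: st; rewrite /loc_step IH; last exact: ltnW.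
case: ifP => t7.
  by move=> /andP[_ /eqP ->]; lia.
by move=> /andP[_ /eqP ->]; have := ltn_pmod t (isT : 0 < 7); lia.
Qed.

Definition is_inc l := if l is Op Inc then true else false.
Definition is_dec l := if l is Op Dec then true else false.
Definition is_tst l := if l is Op Tst then true else false.

Lemma loc_stepS a (i : 'I_7) (l' : loc) (q : i.+1 < 7) :
  loc_step fol fin (a, i) l' -> l' = (a, Ordinal q).
Proof.
case: l' => a' i'; rewrite /loc_step /= ifT; last by rewrite -ltnS.
by move=> /andP[/eqP -> /eqP ii']; congr pair; apply: val_inj.
Qed.

(** The guards determine all seven delays from those in locations 0 and 3. On entry only [clock_y]
    is assumed to be 0, [clock_x] being reset before its first test. *)
Lemma trace_phase n l v d C t a : trace n l v d C -> t + 7 <= n ->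
  l t = (a, ord0) -> (v t clock_y = 0)%R ->
  let x := d t in let y := d (t + 3) in
  let b := (l (t + 7)).1 in let c := loc_letter lab (a, ord0 : 'I_7) in
  [/\ [/\ l (t + 7) = (b, ord0), node_step fol fin a b, (v (t + 7)%N clock_y = 0)%R,
         (l (t + 6)).1 = a & is_tst c -> x = 1%R],
      (0 <= x <= 1)%R, (0 <= y <= 1)%R,
      C (t + 1) = (C t + x)%R /\ C (t + 7) = (C (t + 6)%N + (1 - y))%R
    & C (t + 7) = (C t + x + (is_dec c)%:R * x + (1 - y) + (~~ is_inc c)%:R * y + (1 - y))%R].
Proof.
move=> [_ _ _ tr] tn l0 y0 x y b c.
have step i : i < 7 ->
  [/\ (0 <= d (t + i)%N)%R, loc_step fol fin (l (t + i)) (l (t + i.+1)),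
      val_sat (val_shift (v (t + i)) (d (t + i))) (loc_guard lab (l (t + i))),
      v (t + i.+1) = val_reset (val_shift (v (t + i)) (d (t + i))) (loc_resets (l (t + i)))
    & C (t + i.+1) = (C (t + i)%N + d (t + i)%N * (loc_rate lab (l (t + i)%N))%:R)%R].
  by move=> i7; rewrite addnS; apply: tr; lia.
have [] := step 0 isT; rewrite addn0 l0 => d0 /(@loc_stepS _ ord0 _ isT) l1.
rewrite /= !ffunE y0 => g0 v1 c1.
have [] := step 1 isT; rewrite l1 => d1 /(@loc_stepS _ (@Ordinal 7 1 isT) _ isT) l2.
rewrite /= v1 !ffunE /= !inE /= y0 => g1 v2 c2.
have [] := step 2 isT; rewrite l2 => d2 /(@loc_stepS _ (@Ordinal 7 2 isT) _ isT) l3.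
rewrite /= v2 !ffunE /= !inE /= => g2 v3 c3.
have [] := step 3 isT; rewrite l3 => d3 /(@loc_stepS _ (@Ordinal 7 3 isT) _ isT) l4.
rewrite /= v3 !ffunE /= !inE /= => g3 v4 c4.
have [] := step 4 isT; rewrite l4 => d4 /(@loc_stepS _ (@Ordinal 7 4 isT) _ isT) l5.
rewrite /= v4 !ffunE /= !inE /= => g4 v5 c5.
have [] := step 5 isT; rewrite l5 => d5 /(@loc_stepS _ (@Ordinal 7 5 isT) _ isT) l6.
rewrite /= v5 !ffunE /= !inE /= => g5 v6 c6.
have [] := step 6 isT; rewrite l6 => d6.
rewrite /loc_step /= => /andP[ab /eqP b0].
rewrite /= v6 !ffunE /= !inE /= => g6 v7 c7.
have cE i : loc_letter lab (a, i) = c by [].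
move: g0 c1 c2 c3 c4 c5 c6 c7; rewrite /loc_rate /= !cE -/x -/y.
move: g1 g2 g3 g4 g5 g6 => /eqP g1 /eqP g2 g3 /eqP g4 /eqP g5 /eqP g6.
rewrite ?addn0 -/x -/y in d0 d3 g1 g2 g3 g4 g5 g6 *.
move=> g0 c1 c2 c3 c4 c5 c6 c7.
split.
- split=> //.
  + by rewrite [l _]surjective_pairing; congr pair; apply: val_inj.
  + by rewrite v7 !ffunE /= !inE.
  + by move: g0; case: (c) => [|[]||] //= /eqP; rewrite add0r.
- apply/andP; split; first exact: d0.
  by move: g0; case: (c) => [|[]||] /=; try lra; move=> /eqP; lra.
- by apply/andP; split; lra.
- by split; lra.
- move: c3 c6; case: (c) => [|[]||] /= c3 c6; lra.
Qed.

End Phases.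

(** * Runs of the automaton and words of letters *)

Section Correctness.

Variables (V : finType) (lab : V -> letter) (fol : rel V) (fin : pred V) (v0 : V).
Variable R : realType.

Notation loc := (loc V).
Notation trace := (@trace V lab fol fin v0 R).

(** Phase i starts at cost 2i, so a mark there is met at cost i + i. *)
Definition word_condition (k c : nat) (w : seq letter) : Prop :=
  (exists x y : nat -> R, word_reals k w x y) /\
  exists i, nth Nop w i = Mark /\ i + i = c.

(** Inputs and outputs are the delays in locations 0 and 3 of the phases. Phases of cost 2 give the
    equations of the letters, and the copies give [x (j + k) = y j]. *)
Lemma word_of_trace n l v d C k c : 0 < k -> trace n l v d C ->
  (exists u, [/\ 0 < u <= n, (l u).2 = 0 :> nat, is_mark (loc_letter lab (l u)) & C u = c%:R%R]) ->
  (exists u, [/\ 0 < u <= n, (l u).2 = 0 :> nat & (l u).1 = None]) ->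
  phases_ok n l C -> copies_ok lab n k l C ->
  exists p, [/\ path fol v0 p, fin (last v0 p) & word_condition k c (map lab (v0 :: p))].
Proof.
move=> k0 tr [ul [/andP[_ uln] ul0 ulL ulc]] [uh [/andP[uh0 uhn] uh2 uhN]] P K.
have idx t : t <= n -> (l t).2 = t %% 7 :> nat := trace_index tr.
pose a j := (l (7 * j)).1.
have base j : 7 * j <= n -> l (7 * j) = (a j, ord0) /\ (v (7 * j)%N clock_y = 0)%R.
  elim: j => [|j IH] jn; first by rewrite /a muln0; case: tr => -> -> _ _; rewrite ffunE.
  rewrite mulnSr in jn; have [lj vj] := IH (leq_trans (leq_addr _ _) jn).
  have [[lE _ vE _ _] _ _ _ _] := trace_phase tr jn lj vj.
  by rewrite /a mulnSr vE; split.
have phase j : 7 * j + 7 <= n -> _ := fun jn =>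
  trace_phase tr jn (base j (leq_trans (leq_addr _ _) jn)).1
    (base j (leq_trans (leq_addr _ _) jn)).2.
have stepa j : 7 * j + 7 <= n -> node_step fol fin (a j) (a j.+1).
  by move=> jn; have [[_ ab _ _ _] _ _ _ _] := phase j jn; rewrite /a mulnSr.
pose m := uh %/ 7.
have uhE : uh = 7 * m by have := idx uh uhn; rewrite uh2 /m; lia.
have m0 : 0 < m by lia.
have am : a m = None by rewrite /a -uhE.
(* The node [None] has no successor, so no phase starts after the halting one. *)
have last_phase j : 7 * j <= n -> j <= m.
  move=> jn; rewrite leqNgt; apply/negP => mj.
  suff: node_step fol fin (a m) (a m.+1) by rewrite am.
  by apply: stepa; lia.
have mn j : j < m -> 7 * j + 7 <= n by lia.
have aS j : j < m -> exists x, a j = Some x.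
  by move=> jm; have := stepa j (mn j jm); case: (a j) => // x _; exists x.
have cost2 j : j < m -> (C (7 * j + 7)%N = C (7 * j)%N + 2)%R.
  move=> jm; have jn := mn j jm; have [lj _] := base j (leq_trans (leq_addr _ _) jn).
  have [||u [/andP[tu un] lu nu cu]] := P (7 * j) (leq_trans (leq_addr _ _) jn).
  - by rewrite lj.
  - by rewrite lj /=; have [x ->] := aS j jm.
  (* Starts occur exactly at the multiples of 7, and [nu] excludes any start strictly before [u]. *)
  suff uE : u = 7 * j + 7 by rewrite -uE -cu addrC subrK.
  have u7 := idx u un; rewrite lu in u7.
  case: (ltngtP u (7 * j + 7)) => // ju; first by lia.
  by case: (nu (7 * j + 7)); [lia|rewrite idx //; lia].
have Cj j : j <= m -> C (7 * j) = ((j + j)%:R)%R.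
  elim: j => [|j IH] jm; first by case: tr => _ _ -> _.
  rewrite mulnSr cost2 // IH; last exact: ltnW.
  by rewrite -natrD; congr (_%:R)%R; lia.
pose x j := d (7 * j); pose y j := d (7 * j + 3).
pose vs j := odflt v0 (a j).
have aE j : j < m -> a j = Some (vs j) by move=> jm; rewrite /vs; have [z ->] := aS j jm.
have vs0 : vs 0 = v0 by rewrite /vs /a muln0; case: tr => ->.
pose p := mkseq (vs \o S) m.-1.
have nthp j : j < m -> nth v0 (v0 :: p) j = vs j.
  by case: j => [|j] jm //=; rewrite nth_mkseq //; lia.
have szp : size (v0 :: p) = m by rewrite /= size_mkseq prednK.
have szw : size (map lab (v0 :: p)) = m by rewrite size_map.
have nthw j : j < m -> nth Nop (map lab (v0 :: p)) j = lab (vs j).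
  by move=> jm; rewrite (nth_map v0) ?nthp // szp.
exists p; split.
- apply/(pathP v0) => j; rewrite size_mkseq => jm.
  have -> : nth v0 p j = nth v0 (v0 :: p) j.+1 by [].
  rewrite !nthp; [|lia|lia].
  by have := stepa j; rewrite !aE /=; [apply; lia|lia|lia].
- rewrite (last_nth v0) size_mkseq nthp; last by lia.
  by have := stepa m.-1; rewrite prednK // am aE /=; [apply; lia|lia].
split; last first.
  have ulE : ul = 7 * (ul %/ 7) by have := idx ul uln; rewrite ul0; lia.
  set i := ul %/ 7 in ulE.
  have im : i <= m by apply: last_phase; rewrite -ulE.
  have lab_i : is_mark (loc_letter lab (a i, ord0)).
    by move: ulL; rewrite ulE (base i _).1 // -ulE.
  case: (ltngtP i m) im => // [im|im] _; last by rewrite im am in lab_i.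
  exists i; split.
    by rewrite nthw //; move: lab_i; rewrite aE // /loc_letter /=; case: (lab _).
  by move: ulc; rewrite ulE Cj; [move/eqP; rewrite eqr_nat => /eqP|exact: ltnW].
exists x, y => j; rewrite szw => jm.
have [_ x01 y01 [Cin Cout] Ctot] := phase j (mn j jm).
have lE : loc_letter lab (a j, ord0 : 'I_7) = nth Nop (map lab (v0 :: p)) j.
  by rewrite nthw // aE.
split=> //.
  have [[_ _ _ _ tst] _ _ _ _] := phase j (mn j jm).
  move: Ctot tst; rewrite cost2 // lE -/(x j) -/(y j) => Ctot tst.
  case E : (nth _ _ j) Ctot tst => [|[]||] /= Ctot tst; lra.
move=> jk nF.
have [|||u [/andP[tu un] lu cu]] := K (7 * j + 6).
- by have := mn j jm; lia.
- by rewrite idx; have := mn j jm; lia.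
- have [[_ _ _ l6 _] _ _ _ _] := phase j (mn j jm).
  move: nF; rewrite -lE; suff -> : loc_letter lab (l (7 * j + 6)) =
    loc_letter lab (a j, ord0 : 'I_7) by [].
  by rewrite /loc_letter l6.
have uE : u = 7 * (u %/ 7) + 1 by have := idx u un; rewrite lu; lia.
set i := u %/ 7 in uE.
have Cout' : (C (7 * j + 6)%N = (j + j)%:R + 1 + y j)%R.
  by move: Cout; rewrite cost2 // Cj; [rewrite -/(y j); lra|exact: ltnW].
rewrite -/(x j) -/(y j) in x01 y01.
have kE : (((k + k).-1)%:R + 1 = (k + k)%:R :> R)%R by rewrite natr1 prednK //; lia.
(* The cost at [u] is 2(j + k) + y, with y at most 1, whereas the halting phase starts at cost 2m,
   at least 2(j + k) + 2. *)
have im : i < m.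
  rewrite ltnNge; apply/negP => mi.
  have : (C (7 * m)%N <= C u)%R by apply: trace_cost_le tr _; lia.
  rewrite Cj // => mu.
  have : ((m + m)%:R <= (j + j)%:R + (k + k)%:R + y j :> R)%R by lra.
  by have := leq_add jk jk; rewrite -(ler_nat R) !natrD -!natr1 !natrD; lra.
have [_ xi01 _ [Cin' _] _] := phase i (mn i im).
move: cu; rewrite uE Cin' Cj ?Cout'; last exact: ltnW.
rewrite -/(x i) => cu.
have D : ((i + i)%:R - (j + k + (j + k))%:R = y j - x i :> R)%R by rewrite !natrD in kE *; lra.
(* By [D], [y j - x i] is an even integer, and it lies in [-1, 1]. *)
have ijk : i = j + k.
  have h1 : (-1 <= y j - x i <= 1)%R by rewrite -/(x i) in xi01; lra.
  rewrite !natrD in D; case: (ltngtP i (j + k)) => // h; exfalso.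
    by have := leq_add h h; rewrite -(ler_nat R) !natrD -!natr1 ?natrD; lra.
  by have := leq_add h h; rewrite -(ler_nat R) !natrD -!natr1 ?natrD; lra.
by move: D; rewrite ijk; lra.
Qed.

(** Position t of the trace is location [t %% 7] of phase [t %/ 7]. Every output to be copied has a
    phase k later to receive it, and c > 0 puts the mark after position 0, as the strict until
    demands. *)
Lemma trace_of_word p k c : 0 < k -> 0 < c ->
  path fol v0 p -> fin (last v0 p) ->
  let w := map lab (v0 :: p) in
  (forall j, j < size w -> ~~ is_flush (nth Nop w j) -> j + k < size w) ->
  word_condition k c w ->
  exists n l v d C, [/\ trace n l v d C,
    [/\ exists u, [/\ 0 < u <= n, (l u).2 = 0 :> nat, is_mark (loc_letter lab (l u)) & C u = c%:R%R]
      & exists u, [/\ 0 < u <= n, (l u).2 = 0 :> nat & (l u).1 = None]],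
    phases_ok n l C & copies_ok lab n k l C].
Proof.
move=> k0 c0 pP pF w nflush [[x [y xy]] [il [ilL ilc]]].
pose s := v0 :: p; pose m := size s.
have szw : size w = m by rewrite size_map.
pose a j := if j < m then Some (nth v0 s j) else None.
have i7 t : t %% 7 < 7 by rewrite ltn_pmod.
pose l t : loc := (a (t %/ 7), Ordinal (i7 t)).
have letterE t : loc_letter lab (l t) = nth Nop w (t %/ 7).
  rewrite /loc_letter /= /a; case: ifP => jm; first by rewrite (nth_map v0).
  by rewrite nth_default // szw leqNgt jm.
pose pd j : R := ((is_dec (nth Nop w j))%:R)%R.
pose pi j : R := ((~~ is_inc (nth Nop w j))%:R)%R.
pose delay j i : R := match i with
  | 0 | 2 => x j | 1 => (1 - x j)%R | 3 | 5 => y j | _ => (1 - y j)%R end.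
(* Clock values and cost since the start of phase j, on entering its location i. *)
pose vx j i : R := match i with 2 => (1 - x j)%R | 5 => (1 - y j)%R | _ => 0%R end.
pose vy j i : R := match i with 1 => x j | 4 | 6 => y j | _ => 0%R end.
pose cost j i : R := match i with
  | 0 => 0%R | 1 | 2 => x j | 3 | 4 => (x j + pd j * x j)%R
  | 5 => (x j + pd j * x j + (1 - y j))%R
  | _ => (x j + pd j * x j + (1 - y j) + pi j * y j)%R end.
pose v t : valuation R 2 :=
  [ffun z => if z == clock_x then vx (t %/ 7) (t %% 7) else vy (t %/ 7) (t %% 7)].
pose d t := delay (t %/ 7) (t %% 7).
pose C t : R := (((t %/ 7 + t %/ 7)%N)%:R + cost (t %/ 7)%N (t %% 7)%N)%R.
(* Here the equation of the letter turns into cost 2. *)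
have total j : j < m -> (cost j 6 + (1 - y j) = 2)%R.
  rewrite -szw => jm; have [_ _ lr _] := xy j jm.
  move: lr; rewrite /cost /pd /pi.
  by case: (nth Nop w j) => [|[]||] /=; lra.
have tst j : j < m -> is_tst (nth Nop w j) -> x j = 1%R.
  rewrite -szw => jm; have [_ _ lr _] := xy j jm.
  by move: lr; case: (nth Nop w j) => [|[]||] //= -[].
have C7 j : C (7 * j) = (j + j)%:R%R.
  by rewrite /C mulKn // modnMr addr0.
have div7 j i : i < 7 -> (7 * j + i) %/ 7 = j by lia.
have mod7 j i : i < 7 -> (7 * j + i) %% 7 = i by lia.
exists (7 * m), l, v, d, C; split.
- split.
  + by rewrite /l /a /=; congr pair; apply: val_inj.
  + by apply/ffunP => z; rewrite !ffunE; case: ifP.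
  + by rewrite (C7 0).
  move=> t tm; have jm : t %/ 7 < m by lia.
  have [xj yj _ _] := xy _ (leq_trans jm (eq_leq (esym szw))).
  have tj := total _ jm; have tstj := tst _ jm.
  have next : if t %% 7 < 6 then t.+1 %/ 7 = t %/ 7 /\ t.+1 %% 7 = (t %% 7).+1
     else t.+1 %/ 7 = (t %/ 7).+1 /\ t.+1 %% 7 = 0 by case: ifP; lia.
  have it : t %% 7 < 7 by [].
  split.
  + by rewrite /d /delay; case: (t %% 7) => [|[|[|[|[|[|?]]]]]]; lra.
  + rewrite /loc_step /=; move: next; case: ifP => t6 [-> ->]; first by rewrite !eqxx.
    rewrite andbT /a jm; case: ifP => jm'.
      by move/(pathP v0): pP; apply; rewrite -ltnS.
    by move: pF; rewrite (last_nth v0) /= (_ : size p = t %/ 7) //; rewrite /m /= in jm jm'; lia.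
  + rewrite /loc_guard letterE /= /v /d.
    move: it; case: (t %% 7) => [|[|[|[|[|[|[|//]]]]]]] _ /=; rewrite !ffunE /=;
      [|by apply/eqP; lra|by apply/eqP; lra|by lra|
       by apply/eqP; lra|by apply/eqP; lra|by apply/eqP; lra].
    by move: tstj; case: (nth Nop w _) => [|[]||] /= tstx;
      first [by apply/eqP; rewrite (tstx isT); lra|by clear tstx; lra].
  + apply/ffunP => z; rewrite !ffunE /loc_resets /d /=; move: it next.
    have zE : (z == clock_x) = ~~ (z == clock_y) by case: z => -[|[|]].
    case: (t %% 7) => [|[|[|[|[|[|[|//]]]]]]] _ /= [-> ->]; rewrite !inE /= zE;
      by case: (z == clock_y) => //=; lra.
  + rewrite /C /loc_rate letterE /d /=; move: it next tj.
    case: (t %% 7) => [|[|[|[|[|[|[|//]]]]]]] _ /= [-> ->] /= tj.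
    * by rewrite addr0 mulr1.
    * by rewrite mulr0 addr0.
    * by rewrite addrA /pd; case: (nth Nop w _) => [|[]||] /=; rewrite ?mul1r ?mul0r ?mulr1 ?mulr0.
    * by rewrite mulr0 addr0.
    * by rewrite mulr1 addrA.
    * by rewrite addrA /pi; case: (nth Nop w _) => [|[]||] /=; rewrite ?mul1r ?mul0r ?mulr1 ?mulr0.
    * by rewrite mulr1 -addrA tj addr0 addSn addnS -addn2 natrD.
- split.
    exists (7 * il).
    have ilm : il < m.
      by rewrite -szw ltnNge; apply/negP => ge; rewrite nth_default in ilL.
    by rewrite C7 ilc letterE /l /= modnMr mulKn // ilL; split=> //; lia.
  exists (7 * m); rewrite /l /= modnMr mulKn // /a ltnn; split=> //.
- move=> t tm /= t0 aN; have jm : t %/ 7 < m by move: aN; rewrite /a; case: ifP.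
  have tE : t = 7 * (t %/ 7) by lia.
  exists (7 * (t %/ 7).+1); split; [lia|by rewrite modnMr|by move=> u /=; lia|].
  by have := C7 (t %/ 7); rewrite -tE C7 => ->; rewrite !natrD -!natr1; lra.
- move=> t tm /= t6; rewrite letterE => nF.
  have jm : t %/ 7 < m by lia.
  have jkm : t %/ 7 + k < m by rewrite -szw; apply: nflush; rewrite ?szw.
  exists (7 * (t %/ 7 + k) + 1); split; [lia|by rewrite mod7|].
  rewrite /C div7 // mod7 // t6.
  have [_ _ _ ] := xy _ (leq_trans jm (eq_leq (esym szw))).
  rewrite szw => /(_ jkm nF); rewrite /= => ->; have := total _ jm; rewrite /= => E.
  have kE : (((k + k).-1)%:R + 1 = (k + k)%:R :> R)%R by rewrite natr1 prednK //; lia.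
  by move: kE; rewrite !natrD; lra.
Qed.

End Correctness.

(** * Computability of the reduction *)

Definition computable n (u : n.-tuple nat -> nat) : Prop :=
  exists F : recfun n, forall v, computes F v (u v).

Lemma computes_fun n (f : recfun n) v y y' : computes f v y -> computes f v y' -> y = y'.
Proof.
elim: f v y y' => {n} [n|| n i|k n f IHf g IHg|n f IHf g IHg|n f IHf] v y y' /=.
- by move=> -> ->.
- by move=> -> ->.
- by move=> -> ->.
- case=> w [gw fw] [w' [gw' fw']].
  suff E : w = w' by rewrite E in fw; exact: IHf fw fw'.
  by apply: eq_from_tnth => i; exact: IHg (gw i) (gw' i).
- elim: (thead v) y y' => [|i IH] y y'; first exact: IHf.
  case=> z [/IH pz gz] [z' [/pz E]]; rewrite -E => gz'; exact: IHg gz gz'.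
- case=> fy ly [fy' ly']; case: (ltngtP y y') => // [/ly'|/ly] [u fu].
    by have := IHf _ _ _ fu fy.
  by have := IHf _ _ _ fu fy'.
Qed.

Lemma computable_proj n (i : 'I_n) : computable (fun v => tnth v i).
Proof. by exists (RProj i). Qed.

Lemma computable_comp k n (u : k.-tuple nat -> nat) (g : 'I_k -> n.-tuple nat -> nat) :
  computable u -> (forall i, computable (g i)) ->
  computable (fun v => u [tuple g i v | i < k]).
Proof.
case=> F Fu gc; have [G GP] := boolp.choice gc.
exists (RComp F G) => v /=; exists [tuple g i v | i < k]; split; last exact: Fu.
by move=> i; rewrite tnth_mktuple; exact: GP.
Qed.

Lemma computable_succ n (u : n.-tuple nat -> nat) : computable u -> computable (fun v => (u v).+1).
Proof.
case=> F Fu; exists (RComp RSucc (fun=> F)) => v /=; exists [tuple u v].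
by split=> [i|//]; rewrite ord1.
Qed.

Lemma computable_const n c : computable (fun _ : n.-tuple nat => c).
Proof. by elim: c => [|c IH]; [exists (RZero n)|exact: computable_succ IH]. Qed.

(** The arguments of [s] are the index, the previous value and the parameter, in the order of
    [RPrim]. *)
Lemma computable_rec (f : nat -> nat -> nat) (b : nat -> nat) (s : nat -> nat -> nat -> nat) :
  (forall y, f 0 y = b y) -> (forall i y, f i.+1 y = s i (f i y) y) ->
  computable (fun v : 1.-tuple nat => b (tnth v ord0)) ->
  computable (fun v : 3.-tuple nat =>
    s (tnth v ord0) (tnth v (lift ord0 ord0)) (tnth v (lift ord0 (lift ord0 ord0)))) ->
  forall n (u1 u2 : n.-tuple nat -> nat), computable u1 -> computable u2 ->
  computable (fun v => f (u1 v) (u2 v)).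
Proof.
move=> f0 fS [B BP] [S SP] n u1 u2 c1 c2.
have cf : computable (fun v : 2.-tuple nat => f (tnth v ord0) (tnth v ord_max)).
  exists (RPrim B S) => v.
  have -> : tnth v ord_max = tnth [tuple of behead v] ord0.
    by rewrite tnth_behead; congr tnth; apply: val_inj; rewrite /= inordK.
  rewrite /= -[tnth v ord0]/(thead v); elim: (thead v) => [|i IH]; first by rewrite f0; exact: BP.
  exists (f i (tnth [tuple of behead v] ord0)); split=> //.
  rewrite fS; have := SP [tuple of i :: f i (tnth [tuple of behead v] ord0) :: behead v].
  by rewrite !tnthS.
have := computable_comp (g := fun i : 'I_2 => if i == ord0 then u1 else u2) cf.
have -> : (fun v => f (tnth [tuple (if i == ord0 then u1 else u2) v | i < 2] ord0)
    (tnth [tuple (if i == ord0 then u1 else u2) v | i < 2] ord_max)) = (fun v => f (u1 v) (u2 v)).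
  by apply/funext => v; rewrite !tnth_mktuple.
by apply=> i; case: ifP.
Qed.

Lemma computable_add n (u1 u2 : n.-tuple nat -> nat) :
  computable u1 -> computable u2 -> computable (fun v => u1 v + u2 v).
Proof.
apply: (computable_rec (f := addn) (b := id) (s := fun _ z _ => z.+1)) => //.
  exact: computable_proj.
by apply: computable_succ; exact: computable_proj.
Qed.

Lemma computable_mul n (u1 u2 : n.-tuple nat -> nat) :
  computable u1 -> computable u2 -> computable (fun v => u1 v * u2 v).
Proof.
apply: (computable_rec (f := muln) (b := fun=> 0) (s := fun _ z y => y + z)) => //.
  exact: computable_const.
by apply: computable_add; exact: computable_proj.
Qed.

Lemma computable_exp2 n (u : n.-tuple nat -> nat) : computable u -> computable (fun v => 2 ^ u v).
Proof.
move=> cu; apply: (computable_rec (f := fun i _ => 2 ^ i) (b := fun=> 1)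
  (s := fun _ z _ => z + z) _ _ _ _ cu cu) => //.
- by move=> i _; rewrite expnS mul2n addnn.
- exact: computable_const.
- by apply: computable_add; exact: computable_proj.
Qed.

Lemma computable_pred n (u : n.-tuple nat -> nat) : computable u -> computable (fun v => (u v).-1).
Proof.
move=> cu; apply: (computable_rec (f := fun i _ => i.-1) (b := fun=> 0)
  (s := fun i _ _ => i) _ _ _ _ cu cu) => //.
- exact: computable_const.
- exact: computable_proj.
Qed.

(** Applied along the lists in [code_wmtl], this makes the code of a formula computable from its
    parameters. *)
Lemma computable_code_cons n (u : n.-tuple nat -> nat) (t : n.-tuple nat -> seq nat) :
  computable u -> computable (fun v => CodeSeq.code (t v)) ->
  computable (fun v => CodeSeq.code (u v :: t v)).
Proof.
move=> cu ct.
have -> : (fun v => CodeSeq.code (u v :: t v)) =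
    (fun v => 2 ^ u v * (CodeSeq.code (t v) + CodeSeq.code (t v)).+1).
  by apply/funext => v; rewrite addnn.
apply: computable_mul; first exact: computable_exp2.
by apply: computable_succ; exact: computable_add.
Qed.

(** * Codes of formulas with computable parameters *)

Section Formulas.

Variables (n : nat).
Implicit Types (f g : n.-tuple nat -> wmtl 1 5).

Definition computable_wmtl f := computable (fun v => code_wmtl (f v)).

Lemma computable_wconst phi : computable_wmtl (fun=> phi).
Proof. exact: computable_const. Qed.

Lemma computable_wnot f : computable_wmtl f -> computable_wmtl (fun v => WNot (f v)).
Proof.
move=> cf; apply: (computable_code_cons (t := fun v => [:: code_wmtl (f v)])).
  exact: computable_const.
by apply: (computable_code_cons (t := fun=> [::])) => //; exact: computable_const.
Qed.

Lemma computable_wor f g :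
  computable_wmtl f -> computable_wmtl g -> computable_wmtl (fun v => WOr (f v) (g v)).
Proof.
move=> cf cg; apply: (computable_code_cons (t := fun v => [:: code_wmtl (f v); code_wmtl (g v)])).
  exact: computable_const.
apply: (computable_code_cons (t := fun v => [:: code_wmtl (g v)])) => //.
by apply: (computable_code_cons (t := fun=> [::])) => //; exact: computable_const.
Qed.

Lemma computable_wuntil r (c : n.-tuple nat -> nat) f g :
  computable c -> computable_wmtl f -> computable_wmtl g ->
  computable_wmtl (fun v => WUntil ord0 r (c v) (f v) (g v)).
Proof.
move=> cc cf cg; apply: (computable_code_cons
  (t := fun v => [:: 0; code_cmp r; c v; code_wmtl (f v); code_wmtl (g v)])).
  exact: computable_const.
apply: (computable_code_cons
  (t := fun v => [:: code_cmp r; c v; code_wmtl (f v); code_wmtl (g v)])).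
  exact: computable_const.
apply: (computable_code_cons (t := fun v => [:: c v; code_wmtl (f v); code_wmtl (g v)])).
  exact: computable_const.
apply: (computable_code_cons (t := fun v => [:: code_wmtl (f v); code_wmtl (g v)])) => //.
apply: (computable_code_cons (t := fun v => [:: code_wmtl (g v)])) => //.
by apply: (computable_code_cons (t := fun=> [::])) => //; exact: computable_const.
Qed.

Lemma computable_wand f g :
  computable_wmtl f -> computable_wmtl g -> computable_wmtl (fun v => wand (f v) (g v)).
Proof.
by move=> cf cg; apply: computable_wnot; apply: computable_wor; apply: computable_wnot.
Qed.

Lemma computable_safe_formula (k : n.-tuple nat -> nat) :
  computable k -> computable_wmtl (fun v => safe_formula (k v)).
Proof.
move=> ck; apply: computable_wand; first exact: computable_wconst.
apply: computable_wor; first exact: computable_wconst.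
apply: computable_wuntil; try exact: computable_wconst.
by apply: computable_pred; exact: computable_add.
Qed.

Lemma computable_formula (k c : n.-tuple nat -> nat) :
  computable k -> computable c -> computable_wmtl (fun v => formula (k v) (c v)).
Proof.
move=> ck cc; apply: computable_wand; apply: computable_wand.
- by apply: computable_wuntil => //; exact: computable_wconst.
- exact: computable_wconst.
- exact: computable_safe_formula.
- apply: computable_wnot; apply: computable_wuntil; first exact: computable_const.
    exact: computable_wconst.
  by apply: computable_wnot; exact: computable_safe_formula.
Qed.

End Formulas.

(** * The reduction and the diagonal argument *)

Section Reduction.

Variables (R : realType) (h : recfun 2).

Definition run_regex : regex letter := Sym (Op Tst) ;; program h.

Definition run_start : pos run_regex := inl tt.

Definition run_pta : pta 2 1 5 :=
  automaton (@sym _ run_regex) (@follow _ run_regex) (@final _ run_regex) run_start.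

(** Input n is loaded when the mark has position [nreg h * n.+1], that is, when it is met at twice
    this cost. *)
Definition run_instance (n : nat) : instance :=
  @Instance 5 run_pta
    (@automaton_stopwatch _ (@sym _ run_regex) (@follow _ run_regex) (@final _ run_regex) run_start)
    (formula (nreg h) (nreg h * n.+1 + nreg h * n.+1)).

(** The leading symbol is not nullable, so every accepting path begins at [run_start]. *)
Lemma lang_run_regex w : lang run_regex w <->
  exists p, [/\ path (@follow _ run_regex) run_start p,
    @final _ run_regex (last run_start p) & w = map (@sym _ run_regex) (run_start :: p)].
Proof.
rewrite glushkov; split.
  case=> -[//|[[]|x] p]; first by case/and3P=> _ pp fp ->; exists p.
  by case/and3P=> /andP[].
by case=> p [pp fp ->]; exists (run_start :: p) => //; apply/and3P.
Qed.

Lemma has_model_run_instance n :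
  has_model R (run_instance n) <-> computes h [tuple n; nreg h] 0.
Proof.
have k0 : 0 < nreg h by [].
have flushE m w : has is_flush (body_word h m w) = false.
  by rewrite /body_word flatten_nseq_word !has_cat !has_instr_words //= !has_nseq !andbF.
rewrite -accepted_computes /has_model has_model_trace.
have lastE m w j : nth Nop (body_word h m w ++ nseq (nreg h) Flush) j = Mark <->
    nth Nop (body_word h m w) j = Mark.
  rewrite nth_cat; case: ltnP => // le; rewrite nth_nseq [in X in _ <-> X]nth_default //.
  by case: ifP.
have bodyE m w : exists u, body_word h m w = nseq (nreg h) (Op Tst) ++ u /\ has is_flush u = false.
  rewrite /body_word; eexists; split; first reflexivity.
  by have := flushE m w; rewrite /body_word has_cat => /negbT; rewrite negb_or => /andP[_ /negbTE].
split.
  case=> N [l [v [d [C [tr /(tsat_formula _ _ tr)[ld hl P K]]]]]].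
  have [p [pp fp [[x [y xy]] [i [iL ic]]]]] := word_of_trace k0 tr ld hl P K.
  have [m [w [Lw E]]] := 
    (lang_program _ _).1 ((lang_run_regex _).2 (ex_intro _ p (And3 pp fp erefl))).
  rewrite E in xy iL; exists m, w; split=> //.
  have [u [uE uF]] := bodyE m w.
  have [q qq] : exists q, qexec (nseq (nreg h) (Op Tst) ++ u) (nseq (nreg h) 0) q.
    by apply/(word_realsP R k0 uF); exists x, y; rewrite -uE.
  exists q; first by rewrite uE.
  by apply/lastE; suff <- : i = nreg h * n.+1 by []; lia.
case=> m [w [Lw [q qq L]]].
have [p [pp fp E]] := (lang_run_regex _).1
  ((lang_program h _).2 (ex_intro _ m (ex_intro _ w (conj Lw erefl)))).
have [u [uE uF]] := bodyE m w.
have c0 : 0 < nreg h * n.+1 + nreg h * n.+1 by rewrite addn_gt0 muln_gt0 k0.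
(* A letter other than [Flush] lies in the body, hence is followed by the whole flush of length
   [nreg h]. *)
have nf j : j < size (body_word h m w ++ nseq (nreg h) Flush) ->
    ~~ is_flush (nth Nop (body_word h m w ++ nseq (nreg h) Flush) j) ->
    j + nreg h < size (body_word h m w ++ nseq (nreg h) Flush).
  rewrite size_cat size_nseq nth_cat ltn_add2r => jn; case: ltnP => // le.
  by rewrite nth_nseq ifT //; lia.
have wc : word_condition R (nreg h) (nreg h * n.+1 + nreg h * n.+1)
    (body_word h m w ++ nseq (nreg h) Flush).
  split; last by exists (nreg h * n.+1); split=> //; apply/lastE.
  by rewrite uE; apply/(word_realsP R k0 uF); exists q; rewrite -uE.
rewrite E in nf wc.
have [N [l [v [d [C [tr [ld hl] P K]]]]]] := trace_of_word k0 c0 pp fp nf wc.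
by exists N, l, v, d, C; split=> //; apply/(tsat_formula _ _ tr).
Qed.

End Reduction.

Theorem theorem3p17 (R : realType) :
  undecidable_problem code_instance (has_model R).
Proof.
case=> f fP.
(* From b and k, the code of the instance with automaton code b and the formula for input b and k
   registers; 5 is the number of propositions. *)
pose u (v : 2.-tuple nat) := CodeSeq.code [:: 5; tnth v ord0;
  code_wmtl (formula (tnth v ord_max)
    (tnth v ord_max * (tnth v ord0).+1 + tnth v ord_max * (tnth v ord0).+1))].
have [F FP] : computable u.
  have cp := computable_proj.
  have cc : computable (fun v : 2.-tuple nat => tnth v ord_max * (tnth v ord0).+1).
    by apply: computable_mul => //; apply: computable_succ.
  apply: (computable_code_cons (t := fun v : 2.-tuple nat => [:: tnth v ord0; code_wmtl _])).
    exact: computable_const.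
  apply: (computable_code_cons (t := fun v : 2.-tuple nat => [:: code_wmtl _])) => //.
  apply: (computable_code_cons (t := fun=> [::])); last exact: computable_const.
  by apply: computable_formula => //; exact: computable_add.
pose h := RComp f (fun _ : 'I_1 => F).
(* The diagonal instance: the automaton of [h] receives its own code as input. *)
pose I := run_instance h (code_pta (run_pta h)).
have IE : u [tuple code_pta (run_pta h); nreg h] = code_instance I by [].
have hE : computes h [tuple code_pta (run_pta h); nreg h] 0 <->
    computes f [tuple code_instance I] 0.
  rewrite /= -IE; split=> [[w [Fw fw]]|fw].
    suff -> : [tuple u [tuple code_pta (run_pta h); nreg h]] = w by [].
    by apply: eq_from_tnth => i; rewrite [i]ord1; exact: computes_fun (FP _) (Fw ord0).
  exists [tuple u [tuple code_pta (run_pta h); nreg h]]; split=> // i.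
  by rewrite [i]ord1; exact: FP.
(* A model of [I] would make [f] answer both 0 and 1; without one [f] answers 0, which produces a
   model. *)
have [yes no] := fP I.
have nm : ~ has_model R I.
  move=> hm; have /hE f0 := (has_model_run_instance R h _).1 hm.
  by have := computes_fun (yes hm) f0.
by apply: (nm); apply/has_model_run_instance/hE; exact: no nm.
Qed.
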